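(* Let $h>0$ and $\beta>0$. The equilibrium distribution $(\pi_j)_{j\ge0}$ of the $Q$-process, with generating function $\Pi(s)=\sum_{k=0}^\infty\pi_ks^k$, is given by $$\Pi(s)=\pi_0\Big[1+\frac{s(H(u(\beta))-H(s))}{U_\beta(s)}\Big]+\frac{\sum_{k=1}^{c-1}\pi_k(c-k)b_0\big[s^k(1-s)-su(\beta)^{k-1}(1-u(\beta))\big]}{U_\beta(s)}$$ (for $s\in[0,1]$ with $s\ne u(\beta)$). Furthermore, $$\pi_0=\beta\Big[\beta+H(1)-H(u(\beta))+\sum_{k=1}^{c-1}L_k(\beta)u(\beta)^{k-1}(c-k)b_0(1-u(\beta))\Big]^{-1},\qquad \pi_j=\pi_0L_j(\beta)\quad(j\ge1),$$ where $L_j(\lambda)=\sum_{i=1}^\infty h_i\phi^*_{ij}(\lambda)$.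
   Context: Let $\mathbf E=\{0,1,2,\dots\}$ and let $c\ge 1$ be an integer (the number of servers). Let $(b_j)_{j\ge0}$ be reals with $b_j\ge 0$ for $j\ne 1$, $0<-b_1=\sum_{j\ne1}b_j<\infty$, $b_0>0$ and $\sum_{j\ge2}b_j>0$. Let $\beta>0$ and $h_j\ge0$ ($j\ge1$) with $0<h:=\sum_{j\ge1}h_j<\infty$. The $Q$-process is the continuous-time Markov chain on $\mathbf E$ with conservative bounded $q$-matrix $Q=Q^*+Q_s+Q_d$, where: $Q^*$ has entries $q^*_{i,i-1}=\min(i,c)b_0$, $q^*_{ii}=b_1-[\min(i,c)-1]b_0$, $q^*_{ij}=b_{j-i+1}$ ($j\ge i+1$) for $i\ge1$, and $0$ otherwise; $Q_s$ has entries $q^{(s)}_{00}=-h$, $q^{(s)}_{0j}=h_j$ ($j\ge1$), and $0$ otherwise; $Q_d$ has entries $q^{(d)}_{i0}=\beta$, $q^{(d)}_{ii}=-\beta$ for $i\ge1$, and $0$ otherwise. This process is positive recurrent. Let $(p^*_{ij}(t))$ be the transition function of the chain with $q$-matrix $Q^*$ and $\phi^*_{ij}(\lambda)=\int_0^\infty e^{-\lambda t}p^*_{ij}(t)\,dt$, $\lambda>0$. Define $B(s)=\sum_{j\ge0}b_js^j$, $B_c(s)=B(s)+(c-1)b_0(1-s)$, $U_\lambda(s)=B_c(s)-\lambda s$, $H(s)=\sum_{j\ge1}h_js^j$. For each $\lambda>0$, $u(\lambda)\in(0,1)$ is the unique root of $U_\lambda(s)=0$ on $[0,1]$. Empty sums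 are $0$. *)

(* Defs.v *)
From Stdlib Require Import Reals Arith.
From Coquelicot Require Import Coquelicot.

Open Scope R_scope.

Definition kron (i j : nat) : R := if Nat.eqb i j then 1 else 0.

(* Values at t < 0 are irrelevant: every condition is restricted to t >= 0. *)
Record is_transition_function (p : R -> nat -> nat -> R) : Prop := {
  tf_ge0 : forall t i j, 0 <= t -> 0 <= p t i j;
  tf_sum1 : forall t i, 0 <= t -> is_series (fun j => p t i j) 1;
  tf_init : forall i j, p 0 i j = kron i j;
  tf_chapman_kolmogorov : forall s t i j, 0 <= s -> 0 <= t ->
    is_series (fun k => p s i k * p t k j) (p (s + t) i j)
}.

(* The q-matrix is the entrywise right derivative at 0; its existence contains
   the standardness condition p t i j --> kron i j as t --> 0+. *)
Definition has_qmatrix (p : R -> nat -> nat -> R) (q : nat -> nat -> R) : Prop :=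
  forall i j,
    filterlim (fun t => (p t i j - kron i j) / t) (at_right 0) (locally (q i j)).

Definition is_chain (q : nat -> nat -> R) (p : R -> nat -> nat -> R) : Prop :=
  is_transition_function p /\ has_qmatrix p q.

Record is_equilibrium (p : R -> nat -> nat -> R) (pi : nat -> R) : Prop := {
  eq_ge0 : forall j, 0 <= pi j;
  eq_sum1 : is_series pi 1;
  eq_invariant : forall t j, 0 <= t ->
    is_series (fun i => pi i * p t i j) (pi j)
}.

Definition resolvent (p : R -> nat -> nat -> R) (i j : nat) (lambda : R) : R :=
  RInt_gen (fun t => exp (- lambda * t) * p t i j)
    (at_point 0) (Rbar_locally p_infty).

(* In everything below h is indexed from 1: the value h 0 is never used. *)
Definition htot (h : nat -> R) : R := Series (fun j => h (S j)).

Definition qstar (b : nat -> R) (c i j : nat) : R :=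
  match i with
  | O => 0
  | S i' =>
      if Nat.eqb j i' then INR (Nat.min i c) * b 0%nat
      else if Nat.eqb j i then b 1%nat - (INR (Nat.min i c) - 1) * b 0%nat
      else if Nat.ltb i j then b (j - i + 1)%nat
      else 0
  end.

Definition qs (h : nat -> R) (i j : nat) : R :=
  match i, j with
  | O, O => - htot h
  | O, S _ => h j
  | S _, _ => 0
  end.

Definition qd (beta : R) (i j : nat) : R :=
  match i with
  | O => 0
  | S _ => if Nat.eqb j 0 then beta
           else if Nat.eqb j i then - beta
           else 0
  end.

Definition qmat (b h : nat -> R) (beta : R) (c i j : nat) : R :=
  qstar b c i j + qs h i j + qd beta i j.

Definition Bfun (b : nat -> R) (s : R) : R := PSeries b s.

Definition Bcfun (b : nat -> R) (c : nat) (s : R) : R :=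
  Bfun b s + (INR c - 1) * b 0%nat * (1 - s).

Definition Ufun (b : nat -> R) (c : nat) (lambda s : R) : R :=
  Bcfun b c s - lambda * s.

Definition Hfun (h : nat -> R) (s : R) : R :=
  Series (fun j => h (S j) * s ^ S j).

Definition Lfun (h : nat -> R) (pstar : R -> nat -> nat -> R)
    (j : nat) (lambda : R) : R :=
  Series (fun i => h (S i) * resolvent pstar (S i) j lambda).

(* Main.v *)
Require Import Defs.
From Stdlib Require Import Reals Lra Lia.
From Coquelicot Require Import Coquelicot.

(** Both [qmat b h beta c] and [qstar b c] are conservative with bounded
    diagonal, and everything about their chains is extracted from one fact,
    [flow_derivative]: for a summable row vector [x], the flow [x P(t)] is
    differentiable from the right, uniformly in [t], with derivative
    [(x Q) P(t)].  It comes from the convergence of [(P(s) - I) / s] to [Q] in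
    row-sum norm, a Scheffe argument ([rate_defect_lim]) that rests on the
    inequality [1 + t q_ii <= p_ii(t)] ([diag_lower_bound]).

    Two consequences follow.  First, [pi] is invariant under the chain exactly
    when [pi Q = 0] ([invariant_iff]).  Second, integrating the derivative of
    [exp (- lambda t) x P(t)] over the half-line gives
    [x = (lambda x - x Q) Phi(lambda)] for the resolvent [Phi]
    ([resolvent_equation]).

    Existence: every state [i >= 1] jumps to [0] at rate at least [beta], so up
    to scaling [I + Q] is a mixture of a jump to [0] with fixed positive weight
    and a nonnegative matrix of norm less than one; a geometric series solves
    [pi Q = 0] ([stationary_exists]).

    Identification: let [pi Q = 0].  Outside column [0] this reads
    [beta pi - pi Qstar = pi_0 h], so the resolvent equation for [Qstar] turns it into
    [pi_j = pi_0 L_j(beta)] ([stationary_resolvent]).  Multiplying by [s ^ j] and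
    summing gives the functional equation [balance_equation] for the generating
    function.  Its left-hand side vanishes at the root [u(beta)], which
    expresses [beta (1 - pi_0)] through [pi_0, ..., pi_(c-1)]; substituting this
    back gives the formula for the generating function, and combining it with
    [pi_j = pi_0 L_j(beta)] gives [pi_0].  Division by [U_beta(s)] is legitimate
    since [U_beta] is convex and negative at [1], hence has only one root in
    [[0, 1]] ([Ufun_neq0]). *)

Open Scope R_scope.

(** * Series of reals: dominated convergence and interchange of sums *)

Lemma filterlim_Rabs_lt {T : Type} (F : (T -> Prop) -> Prop) {FF : Filter F}
  (f : T -> R) (l : R) :
  filterlim f F (locally l) <->
  forall eps, 0 < eps -> F (fun x => Rabs (f x - l) < eps).
Proof.
  split.
  - intros H eps He.
    apply (proj1 (filterlim_locally f l) H (mkposreal eps He)).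
  - intros H. apply filterlim_locally. intros [eps He]. now apply H.
Qed.

Lemma ex_series_dominated (a g : nat -> R) :
  (forall i, Rabs (a i) <= g i) -> ex_series g -> ex_series a.
Proof. intros H Hg. now apply (ex_series_le a g). Qed.

Lemma Series_dominated (a g : nat -> R) :
  (forall i, Rabs (a i) <= g i) -> ex_series g -> Rabs (Series a) <= Series g.
Proof.
  intros H Hg.
  assert (Ha : ex_series (fun i => Rabs (a i))).
  { apply (ex_series_dominated _ g); [|assumption].
    intros i. now rewrite Rabs_Rabsolu. }
  eapply Rle_trans; [now apply Series_Rabs|].
  apply Series_le; [|assumption]. intros n. split; [apply Rabs_pos|apply H].
Qed.

Lemma ex_series_Rplus (a b : nat -> R) :
  ex_series a -> ex_series b -> ex_series (fun n => a n + b n).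
Proof. exact (ex_series_plus a b). Qed.

Lemma ex_series_Rminus (a b : nat -> R) :
  ex_series a -> ex_series b -> ex_series (fun n => a n - b n).
Proof. exact (ex_series_minus a b). Qed.

Lemma ex_series_Rmult (c : R) (a : nat -> R) :
  ex_series a -> ex_series (fun n => c * a n).
Proof. exact (ex_series_scal c a). Qed.

Lemma is_series_Rplus (a b : nat -> R) (la lb : R) :
  is_series a la -> is_series b lb -> is_series (fun n => a n + b n) (la + lb).
Proof. exact (is_series_plus a b la lb). Qed.

Lemma is_series_Rmult (c : R) (a : nat -> R) (l : R) :
  is_series a l -> is_series (fun n => c * a n) (c * l).
Proof. exact (is_series_scal c a l). Qed.

Lemma is_series_value (a : nat -> R) (l l' : R) : is_series a l -> l = l' -> is_series a l'.
Proof. now intros H <-. Qed.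

Lemma is_series_Rext (a b : nat -> R) (l : R) :
  (forall n, a n = b n) -> is_series a l -> is_series b l.
Proof. exact (is_series_ext a b l). Qed.

Lemma ex_series_Rext (a b : nat -> R) :
  (forall n, a n = b n) -> ex_series a -> ex_series b.
Proof. exact (ex_series_ext a b). Qed.

Lemma Series_Rcorrect (a : nat -> R) : ex_series a -> is_series a (Series a).
Proof. exact (Series_correct a). Qed.

Lemma Series_0 : Series (fun _ : nat => 0) = 0.
Proof.
  rewrite (Series_ext _ (fun _ => 0 * 0)); [|intros; ring].
  rewrite Series_scal_l. ring.
Qed.

Lemma Series_nonneg (a : nat -> R) : (forall n, 0 <= a n) -> ex_series a -> 0 <= Series a.
Proof.
  intros H Ha.
  rewrite <- Series_0. apply Series_le; [|assumption].
  intros n. split; [lra|apply H].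
Qed.

Lemma sum_f_R0_le_Series (a : nat -> R) N :
  (forall n, 0 <= a n) -> ex_series a -> sum_f_R0 a N <= Series a.
Proof.
  intros H Ha. rewrite (Series_incr_n a (S N)); [|lia|assumption]. simpl pred.
  assert (0 <= Series (fun k => a (S N + k)%nat)); [|lra].
  apply Series_nonneg; [intros; apply H|].
  now apply -> (ex_series_incr_n a (S N)).
Qed.

Lemma term_le_Series (a : nat -> R) k :
  (forall n, 0 <= a n) -> ex_series a -> a k <= Series a.
Proof.
  intros H Ha. eapply Rle_trans; [|exact (sum_f_R0_le_Series a k H Ha)].
  destruct k as [|k]; simpl; [lra|].
  assert (0 <= sum_f_R0 a k) by (apply cond_pos_sum; exact H). lra.
Qed.

Lemma tail_small (g : nat -> R) (eps : R) :
  ex_series g -> 0 < eps ->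
  exists N, Rabs (Series (fun k => g (S N + k)%nat)) < eps.
Proof.
  intros Hg He.
  assert (H := Series_Rcorrect g Hg).
  apply is_series_Reals in H. destruct (H eps He) as [N HN].
  exists N. specialize (HN N (le_n N)). unfold R_dist in HN.
  rewrite (Series_incr_n g (S N)) in HN; [|lia|assumption]. simpl pred in HN.
  rewrite Rabs_minus_sym in HN.
  match goal with H : Rabs ?x < _ |- Rabs ?y < _ => replace y with x by lra end.
  assumption.
Qed.

(** Cut all the series at an index beyond which the dominating series is small;
    the remaining finite sums converge term by term. *)
Lemma dominated_convergence_series {T : Type} (F : (T -> Prop) -> Prop)
  {FF : Filter F} (a : T -> nat -> R) (l g : nat -> R) :
  ex_series g ->
  (forall i, Rabs (l i) <= g i) ->
  F (fun x => forall i, Rabs (a x i) <= g i) ->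
  (forall i, filterlim (fun x => a x i) F (locally (l i))) ->
  filterlim (fun x => Series (a x)) F (locally (Series l)).
Proof.
  intros Hg Hl Ha Hlim. apply (filterlim_Rabs_lt F). intros eps He.
  (* The tails contribute at most 2 * (eps / 4), the head less than eps / 2. *)
  destruct (tail_small g (eps / 4) Hg) as [N HN]; [lra|].
  assert (Hfin : forall e, 0 < e ->
    F (fun x => sum_f_R0 (fun i => Rabs (a x i - l i)) N < e)).
  { induction N as [|N IH] in |- *; intros e Hpos.
    - exact (proj1 (filterlim_Rabs_lt F _ _) (Hlim 0%nat) e Hpos).
    - generalize (filter_and (F := F) _ _ (IH (e / 2) ltac:(lra))
        (proj1 (filterlim_Rabs_lt F _ _) (Hlim (S N)) (e / 2) ltac:(lra))).
      apply filter_imp. intros x [H1 H2]. simpl. lra. }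
  generalize (filter_and (F := F) _ _ Ha (Hfin (eps / 2) ltac:(lra))).
  apply filter_imp. intros x [Hx Hs].
  assert (Hax : ex_series (a x)) by now apply (ex_series_dominated _ g).
  assert (Hlx : ex_series l) by now apply (ex_series_dominated _ g).
  rewrite <- Series_minus by assumption.
  assert (Hd : forall i, Rabs (a x i - l i) <= 2 * g i).
  { intros i. specialize (Hx i). specialize (Hl i).
    unfold Rminus. eapply Rle_trans; [apply Rabs_triang|]. rewrite Rabs_Ropp. lra. }
  assert (Hab : ex_series (fun i => Rabs (a x i - l i))).
  { apply (ex_series_dominated _ (fun i => 2 * g i)).
    - intros i. now rewrite Rabs_Rabsolu.
    - now apply ex_series_Rmult. }
  eapply Rle_lt_trans; [now apply Series_Rabs|].
  rewrite (Series_incr_n _ (S N)); [|lia|assumption]. simpl pred.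
  assert (Hgt : ex_series (fun k => g (S N + k)%nat))
    by now apply -> (ex_series_incr_n g (S N)).
  assert (Series (fun k => Rabs (a x (S N + k)%nat - l (S N + k)%nat))
          <= Series (fun k => 2 * g (S N + k)%nat)).
  { apply Series_le; [|now apply ex_series_Rmult].
    intros k. split; [apply Rabs_pos|apply Hd]. }
  rewrite Series_scal_l in H. apply Rabs_lt_between in HN. lra.
Qed.

Lemma is_series_filterlim (a : nat -> R) (l : R) :
  filterlim (sum_f_R0 a) eventually (locally l) -> is_series a l.
Proof.
  intros H. unfold is_series.
  apply (filterlim_ext (sum_f_R0 a)); [|exact H].
  intros n. now rewrite sum_n_Reals.
Qed.

Lemma filterlim_is_series (a : nat -> R) (l : R) :
  is_series a l -> filterlim (sum_f_R0 a) eventually (locally l).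
Proof.
  intros H.
  apply (filterlim_ext (sum_n a)); [|exact H].
  intros n. now rewrite sum_n_Reals.
Qed.

Lemma sum_f_R0_Series (a : nat -> nat -> R) N :
  (forall k, ex_series (fun i => a i k)) ->
  ex_series (fun i => sum_f_R0 (a i) N) /\
  sum_f_R0 (fun k => Series (fun i => a i k)) N = Series (fun i => sum_f_R0 (a i) N).
Proof.
  intros H. induction N as [|N [IH1 IH2]]; simpl.
  - split; [apply H|reflexivity].
  - split; [now apply ex_series_Rplus|]. rewrite IH2. now rewrite <- Series_plus.
Qed.

(** The partial sums over [k] of the double series converge, row by row, to the
    row sums and are dominated by [g]: this is dominated convergence in [i]. *)
Lemma Series_Fubini (a : nat -> nat -> R) (g : nat -> R) :
  ex_series g ->
  (forall i, ex_series (fun k => Rabs (a i k))) ->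
  (forall i, Series (fun k => Rabs (a i k)) <= g i) ->
  is_series (fun k => Series (fun i => a i k)) (Series (fun i => Series (a i))).
Proof.
  intros Hg Hr Hb.
  assert (Hsum : forall i n, sum_f_R0 (fun k => Rabs (a i k)) n <= g i).
  { intros i n. eapply Rle_trans; [|apply Hb].
    apply sum_f_R0_le_Series; [intros; apply Rabs_pos|apply Hr]. }
  assert (Hcol : forall k, ex_series (fun i => a i k)).
  { intros k. apply (ex_series_dominated _ g); [|assumption]. intros i.
    eapply Rle_trans; [|apply Hb].
    apply (term_le_Series (fun k => Rabs (a i k))); [intros; apply Rabs_pos|apply Hr]. }
  apply is_series_filterlim.
  apply (filterlim_ext (fun n => Series (fun i => sum_f_R0 (a i) n))).
  { intros n. symmetry. now apply sum_f_R0_Series. }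
  apply (dominated_convergence_series eventually) with (g := g); try assumption.
  - intros i. eapply Rle_trans; [now apply Series_Rabs|apply Hb].
  - exists 0%nat. intros n _ i. eapply Rle_trans; [apply Rsum_abs|apply Hsum].
  - intros i. apply filterlim_is_series. apply Series_Rcorrect. now apply ex_series_Rabs.
Qed.

Lemma kron_refl i : kron i i = 1.
Proof. unfold kron. now rewrite Nat.eqb_refl. Qed.

Lemma kron_neq i j : i <> j -> kron i j = 0.
Proof. unfold kron. intros H. now apply Nat.eqb_neq in H as ->. Qed.

Lemma kron_ge0 i j : 0 <= kron i j.
Proof. unfold kron. destruct (Nat.eqb i j); lra. Qed.

Lemma is_series_single (a : nat -> R) i :
  (forall k, k <> i -> a k = 0) -> is_series a (a i).
Proof.
  intros H. apply is_series_filterlim. apply (filterlim_Rabs_lt eventually).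
  intros eps He. exists i. intros n Hn.
  replace (sum_f_R0 a n) with (a i).
  - replace (a i - a i) with 0 by lra. now rewrite Rabs_R0.
  - assert (Hz : forall m, (m < i)%nat -> sum_f_R0 a m = 0).
    { induction m as [|m IH]; intros Hm; simpl; [apply H; lia|].
      rewrite IH, H by lia. lra. }
    induction Hn as [|m Hm IH].
    + destruct i as [|i]; simpl; [reflexivity|]. rewrite Hz by lia. lra.
    + simpl. rewrite <- IH, (H (S m)) by lia. lra.
Qed.

Lemma is_series_kron (f : nat -> R) i : is_series (fun k => kron i k * f k) (f i).
Proof.
  eapply is_series_value; [apply (is_series_single _ i)|].
  - intros k Hk. rewrite kron_neq by congruence. lra.
  - cbv beta. rewrite kron_refl. lra.
Qed.

Lemma is_series_kron1 i : is_series (fun k => kron i k) 1.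
Proof.
  eapply is_series_ext; [|exact (is_series_kron (fun _ => 1) i)].
  intros k. cbv beta. lra.
Qed.

(** * Row vectors times matrices *)

Definition l1 (x : nat -> R) : Prop := ex_series (fun i => Rabs (x i)).

Definition vmul (x : nat -> R) (A : nat -> nat -> R) (j : nat) : R :=
  Series (fun i => x i * A i j).

Definition rows_bounded (A : nat -> nat -> R) (C : R) : Prop :=
  forall i, ex_series (fun k => Rabs (A i k)) /\ Series (fun k => Rabs (A i k)) <= C.

Lemma rows_bounded_entry A C i k : rows_bounded A C -> Rabs (A i k) <= C.
Proof.
  intros H. destruct (H i) as [He Hb]. eapply Rle_trans; [|exact Hb].
  apply (term_le_Series (fun k => Rabs (A i k))); [intros; apply Rabs_pos|exact He].
Qed.

Lemma ex_series_l1_mult x f C :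
  l1 x -> (forall i, Rabs (f i) <= C) -> ex_series (fun i => x i * f i).
Proof.
  intros Hx Hf. apply (ex_series_dominated _ (fun i => C * Rabs (x i))).
  - intros i. rewrite Rabs_mult, Rmult_comm.
    apply Rmult_le_compat_r; [apply Rabs_pos|apply Hf].
  - now apply ex_series_Rmult.
Qed.

(** The associativity [(x A) f = x (A f)], which is an interchange of sums. *)
Lemma vmul_assoc x A f C D :
  l1 x -> rows_bounded A C -> (forall k, Rabs (f k) <= D) ->
  is_series (fun k => vmul x A k * f k)
            (Series (fun i => x i * Series (fun k => A i k * f k))).
Proof.
  intros Hx HA Hf.
  apply (is_series_Rext (fun k => Series (fun i => x i * (A i k * f k)))).
  { intros k. unfold vmul. rewrite <- Series_scal_r.
    apply Series_ext. intros i. ring. }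
  assert (Hb : forall i k, Rabs (x i * (A i k * f k)) <= (Rabs (x i) * D) * Rabs (A i k)).
  { intros i k. rewrite !Rabs_mult.
    replace (Rabs (x i) * D * Rabs (A i k))
      with (Rabs (x i) * (Rabs (A i k) * D)) by ring.
    apply Rmult_le_compat_l; [apply Rabs_pos|].
    apply Rmult_le_compat_l; [apply Rabs_pos|apply Hf]. }
  assert (HD : 0 <= D) by (eapply Rle_trans; [apply Rabs_pos|apply (Hf 0%nat)]).
  assert (Hex : forall i, ex_series (fun k => Rabs (x i) * D * Rabs (A i k))).
  { intros i. apply ex_series_Rmult, HA. }
  eapply is_series_value.
  - apply (Series_Fubini (fun i k => x i * (A i k * f k)) (fun i => (D * C) * Rabs (x i))).
    + now apply ex_series_Rmult.
    + intros i. apply (ex_series_dominated _ _ (fun k => eq_rect_r (fun r => r <= _)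
        (Hb i k) (Rabs_Rabsolu _)) (Hex i)).
    + intros i.
      apply Rle_trans with (Series (fun k => Rabs (x i) * D * Rabs (A i k))).
      * apply Series_le; [|apply Hex]. intros k. split; [apply Rabs_pos|apply Hb].
      * rewrite Series_scal_l.
        replace (D * C * Rabs (x i)) with (Rabs (x i) * D * C) by ring.
        apply Rmult_le_compat_l; [|apply HA].
        apply Rmult_le_pos; [apply Rabs_pos|assumption].
  - apply Series_ext. intros i. apply Series_scal_l.
Qed.

Lemma vmul_l1 x A C : l1 x -> rows_bounded A C -> l1 (vmul x A).
Proof.
  intros Hx HA. unfold l1.
  assert (Hx' : l1 (fun i => Rabs (x i))).
  { unfold l1. eapply ex_series_Rext; [|exact Hx]. intros n. now rewrite Rabs_Rabsolu. }
  assert (HA' : rows_bounded (fun i k => Rabs (A i k)) C).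
  { intros i. destruct (HA i) as [H1 H2]. split.
    - eapply ex_series_Rext; [|exact H1]. intros n. now rewrite Rabs_Rabsolu.
    - eapply Rle_trans; [|exact H2]. right. apply Series_ext. intros n. apply Rabs_Rabsolu. }
  apply (ex_series_dominated _
    (fun k => vmul (fun i => Rabs (x i)) (fun i k => Rabs (A i k)) k * 1)).
  - intros k. rewrite Rabs_Rabsolu, Rmult_1_r. apply Series_dominated.
    + intros i. rewrite Rabs_mult. apply Rle_refl.
    + apply (ex_series_l1_mult _ _ C Hx').
      intros i. now apply (rows_bounded_entry _ _ i k HA').
  - eexists. apply (vmul_assoc _ _ (fun _ => 1) C 1 Hx' HA').
    intros k. rewrite Rabs_R1. lra.
Qed.

(** * Bounded generators and the short-time behaviour of their chains *)

Record bounded_generator (q : nat -> nat -> R) (M : R) : Prop := {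
  bg_off : forall i j, i <> j -> 0 <= q i j;
  bg_row : forall i, is_series (q i) 0;
  bg_bound : forall i, - q i i <= M
}.

(** The positive and negative parts of a row have the same total, because the
    row sums to zero and only its diagonal entry is negative. *)
Lemma bg_row_abs q M i :
  bounded_generator q M -> is_series (fun k => Rabs (q i k)) (- 2 * q i i).
Proof.
  intros [Hoff Hrow _].
  assert (H : is_series (fun k => q i k + (- q i i) * kron i k) (- q i i)).
  { eapply is_series_value; [apply is_series_Rplus; [apply Hrow|apply is_series_Rmult]|].
    - apply is_series_kron1.
    - lra. }
  assert (Hq : 0 <= - q i i).
  { rewrite <- (is_series_unique _ _ H). apply Series_nonneg; [|(eexists; eassumption)].
    intros n. destruct (Nat.eq_dec i n) as [<-|Hn].
    - rewrite kron_refl. lra.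
    - rewrite (kron_neq i n Hn). specialize (Hoff i n Hn). lra. }
  eapply is_series_Rext; [|eapply is_series_value;
    [apply is_series_Rplus; [exact (Hrow i)|
       exact (is_series_Rmult (- 2 * q i i) _ _ (is_series_kron1 i))]|]].
  - intros n. cbv beta. destruct (Nat.eq_dec i n) as [<-|Hn].
    + rewrite kron_refl, Rabs_left1 by lra. lra.
    + rewrite (kron_neq i n Hn), Rabs_pos_eq by now apply Hoff. lra.
  - lra.
Qed.

Lemma bg_rows_bounded q M : bounded_generator q M -> rows_bounded q (2 * M).
Proof.
  intros H i. pose proof (bg_row_abs q M i H) as Hs. split; [(eexists; eassumption)|].
  rewrite (is_series_unique _ _ Hs). pose proof (bg_bound q M H i). lra.
Qed.

Lemma tf_le1 p t i j : is_transition_function p -> 0 <= t -> p t i j <= 1.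
Proof.
  intros H Ht. rewrite <- (is_series_unique _ _ (tf_sum1 p H t i Ht)).
  apply (term_le_Series (fun k => p t i k)).
  - intros; now apply (tf_ge0 p H).
  - eexists; now apply (tf_sum1 p H).
Qed.

Lemma tf_Rabs_le1 p t i j : is_transition_function p -> 0 <= t -> Rabs (p t i j) <= 1.
Proof.
  intros H Ht. rewrite Rabs_pos_eq; [now apply tf_le1|now apply (tf_ge0 p H)].
Qed.

(** Remaining at [i] at each of the [n] times is one way of being at [i] at the
    last one. *)
Lemma tf_diag_pow p t i n :
  is_transition_function p -> 0 <= t -> p t i i ^ n <= p (INR n * t) i i.
Proof.
  intros H Ht. induction n as [|n IH].
  - simpl. rewrite Rmult_0_l, (tf_init p H), kron_refl. lra.
  - rewrite S_INR. replace ((INR n + 1) * t) with (t + INR n * t) by ring.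
    assert (Hn : 0 <= INR n * t) by (apply Rmult_le_pos; [apply pos_INR|assumption]).
    assert (Hck := tf_chapman_kolmogorov p H t (INR n * t) i i Ht Hn).
    rewrite <- (is_series_unique _ _ Hck). simpl.
    assert (Hk : forall k, 0 <= p t i k * p (INR n * t) k i).
    { intros k. apply Rmult_le_pos; now apply (tf_ge0 p H). }
    apply Rle_trans with (p t i i * p (INR n * t) i i).
    + apply Rmult_le_compat_l; [now apply (tf_ge0 p H)|assumption].
    + apply (term_le_Series _ i Hk). eexists; eassumption.
Qed.

Lemma at_right_0_inv_nat t : 0 < t ->
  filterlim (fun n => t / INR (S n)) eventually (at_right 0).
Proof.
  intros Ht P [d Hd].
  destruct (archimed_cor1 (d / t)) as [N [HN HN0]].
  { apply Rdiv_lt_0_compat; [apply d|assumption]. }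
  exists N. intros n Hn. apply Hd.
  - assert (0 < INR N) by now apply lt_0_INR.
    assert (INR N <= INR (S n)) by (apply le_INR; lia).
    unfold ball; simpl; unfold AbsRing_ball, minus, plus, opp, abs; simpl.
    rewrite Ropp_0, Rplus_0_r, Rabs_pos_eq.
    + apply Rle_lt_trans with (t * / INR N).
      * apply Rmult_le_compat_l; [lra|]. now apply Rinv_le_contravar.
      * replace (pos d) with (t * (d / t)) by (field; lra).
        now apply Rmult_lt_compat_l.
    + left. apply Rdiv_lt_0_compat; [assumption|]. apply (lt_0_INR (S n)). lia.
  - apply Rdiv_lt_0_compat; [assumption|]. apply lt_0_INR. lia.
Qed.

Lemma Bernoulli_inequality x n : -1 <= x -> 1 + INR n * x <= (1 + x) ^ n.
Proof.
  intros Hx. induction n as [|n IH]; [simpl; lra|].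
  rewrite S_INR. simpl. assert (H := pos_INR n).
  apply Rle_trans with ((1 + x) * (1 + INR n * x)); [|apply Rmult_le_compat_l; lra].
  assert (0 <= INR n * (x * x)) by (apply Rmult_le_pos; [assumption|apply Rle_0_sqr]).
  lra.
Qed.

(** By Bernoulli's inequality the [n]-th power of [p (t / n) i i] is at least
    [1 + n (p (t / n) i i - 1)], which tends to [1 + t q_ii]. *)
Lemma diag_lower_bound p q t i :
  is_chain q p -> 0 <= t -> 1 + t * q i i <= p t i i.
Proof.
  intros [Hp Hq] Ht. destruct Ht as [Ht| <-].
  2:{ rewrite (tf_init p Hp), kron_refl. lra. }
  assert (Hlim := filterlim_comp _ _ _ _ _ _ _ _ (at_right_0_inv_nat t Ht) (Hq i i)).
  assert (Hc : forall n, 1 + t * ((p (t / INR (S n)) i i - kron i i) / (t / INR (S n)))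
                         <= p t i i).
  { intros n. assert (Hn : 0 < INR (S n)) by (apply lt_0_INR; lia).
    assert (Htn : 0 < t / INR (S n)) by now apply Rdiv_lt_0_compat.
    rewrite kron_refl.
    replace (t * ((p (t / INR (S n)) i i - 1) / (t / INR (S n))))
      with (INR (S n) * (p (t / INR (S n)) i i - 1)) by (field; lra).
    eapply Rle_trans; [apply Bernoulli_inequality|].
    - assert (0 <= p (t / INR (S n)) i i) by (apply (tf_ge0 p Hp); lra). lra.
    - replace (1 + (p (t / INR (S n)) i i - 1)) with (p (t / INR (S n)) i i) by ring.
      eapply Rle_trans; [apply tf_diag_pow; [assumption|lra]|].
      replace (INR (S n) * (t / INR (S n))) with t by (field; lra). lra. }
  apply Rnot_lt_le. intros Hlt.
  assert (He : 0 < (1 + t * q i i - p t i i) / t) by (apply Rdiv_lt_0_compat; lra).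
  destruct (proj1 (filterlim_Rabs_lt eventually _ _) Hlim _ He) as [N HN].
  specialize (HN N (le_n N)). specialize (Hc N). cbv beta in HN.
  apply Rabs_lt_between in HN. destruct HN as [HN _].
  apply (Rmult_lt_compat_l t) in HN; [|assumption].
  replace (t * - ((1 + t * q i i - p t i i) / t)) with (p t i i - (1 + t * q i i)) in HN
    by (field; lra).
  rewrite Rmult_minus_distr_l in HN. lra.
Qed.

Definition rate_defect (p : R -> nat -> nat -> R) (q : nat -> nat -> R) (i : nat)
  (s : R) : R := Series (fun k => Rabs ((p s i k - kron i k) / s - q i k)).

(** Scheffe's device.  Writing [r] for the difference quotient of the row, [r]
    and [q i] both sum to zero, so [|r - q| = (r - q) + 2 max(0, q - r)] sums to
    twice the positive part.  The positive part is dominated by [|q i|]: off the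
    diagonal because [r >= 0], on the diagonal because [r_i >= q_ii]. *)
Lemma rate_defect_Scheffe p q M i s :
  is_chain q p -> bounded_generator q M -> 0 < s ->
  ex_series (fun k => Rabs ((p s i k - kron i k) / s - q i k)) /\
  (forall k, Rabs (Rmax 0 (q i k - (p s i k - kron i k) / s)) <= Rabs (q i k)) /\
  rate_defect p q i s =
    2 * Series (fun k => Rmax 0 (q i k - (p s i k - kron i k) / s)).
Proof.
  intros Hc Hq Hs. pose proof (proj1 Hc) as Hp.
  set (r := fun k => (p s i k - kron i k) / s).
  assert (Hdom : forall k, Rabs (Rmax 0 (q i k - r k)) <= Rabs (q i k)).
  { intros k. rewrite Rabs_pos_eq by apply Rmax_l. unfold r.
    destruct (Nat.eq_dec i k) as [<-|Hk].
    - rewrite kron_refl.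
      assert (q i i <= (p s i i - 1) / s).
      { assert (H := diag_lower_bound p q s i Hc (Rlt_le _ _ Hs)).
        apply (Rmult_le_reg_l s); [assumption|].
        replace (s * ((p s i i - 1) / s)) with (p s i i - 1) by (field; lra). lra. }
      apply Rmax_lub; [apply Rabs_pos|]. pose proof (Rabs_pos (q i i)). lra.
    - rewrite kron_neq by assumption.
      assert (0 <= (p s i k - 0) / s).
      { apply Rdiv_le_0_compat; [|assumption].
        assert (H := tf_ge0 p Hp s i k (Rlt_le _ _ Hs)). lra. }
      apply Rmax_lub; [apply Rabs_pos|]. pose proof (Rle_abs (q i k)). lra. }
  assert (Hm : ex_series (fun k => Rmax 0 (q i k - r k))).
  { apply (ex_series_dominated _ _ Hdom). eexists. now apply (bg_row_abs q M). }
  assert (Hr : is_series r 0).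
  { eapply is_series_Rext; [|eapply is_series_value; [apply (is_series_Rmult (/ s));
      apply is_series_Rplus; [exact (tf_sum1 p Hp s i (Rlt_le _ _ Hs))|
      exact (is_series_Rmult (-1) _ _ (is_series_kron1 i))]|]].
    - intros k. unfold r, Rdiv. cbv beta. ring.
    - ring. }
  assert (Hsum : is_series (fun k => (r k + (-1) * q i k) + 2 * Rmax 0 (q i k - r k))
    (2 * Series (fun k => Rmax 0 (q i k - r k)))).
  { eapply is_series_value; [apply is_series_Rplus; [apply is_series_Rplus;
      [exact Hr|exact (is_series_Rmult (-1) _ _ (bg_row q M Hq i))]|
      exact (is_series_Rmult 2 _ _ (Series_Rcorrect _ Hm))]|]. ring. }
  assert (Habs : is_series (fun k => Rabs (r k - q i k))
    (2 * Series (fun k => Rmax 0 (q i k - r k)))).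
  { eapply is_series_Rext; [|exact Hsum]. intros k. cbv beta.
    unfold Rmax, Rabs. destruct (Rle_dec 0 (q i k - r k)), (Rcase_abs (r k - q i k)); lra. }
  split; [(eexists; eassumption)|]. split; [exact Hdom|]. exact (is_series_unique _ _ Habs).
Qed.

Lemma rate_defect_bound p q M i s :
  is_chain q p -> bounded_generator q M -> 0 < s ->
  0 <= rate_defect p q i s <= 4 * M.
Proof.
  intros Hc Hq Hs. destruct (rate_defect_Scheffe p q M i s Hc Hq Hs) as (He & Hd & Heq).
  split.
  - apply Series_nonneg; [intros; apply Rabs_pos|assumption].
  - rewrite Heq. assert (Hrow := bg_row_abs q M i Hq).
    assert (Hb := Series_dominated _ _ Hd ltac:((eexists; eassumption))).
    rewrite (is_series_unique _ _ Hrow) in Hb.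
    assert (Hm := bg_bound q M Hq i). apply Rabs_le_between in Hb. lra.
Qed.

Lemma at_right_0_pos : at_right 0 (fun s => 0 < s).
Proof. exists (mkposreal 1 Rlt_0_1). now intros y _ Hy. Qed.

Lemma rate_defect_lim p q M i :
  is_chain q p -> bounded_generator q M ->
  filterlim (rate_defect p q i) (at_right 0) (locally 0).
Proof.
  intros Hc Hq. apply (filterlim_Rabs_lt (at_right 0)). intros eps He.
  assert (Hlim : filterlim
    (fun s => Series (fun k => Rmax 0 (q i k - (p s i k - kron i k) / s)))
    (at_right 0) (locally (Series (fun _ : nat => 0)))).
  { apply (dominated_convergence_series (at_right 0)) with (g := fun k => Rabs (q i k)).
    - eexists. now apply (bg_row_abs q M).
    - intros k. rewrite Rabs_R0. apply Rabs_pos.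
    - generalize at_right_0_pos. apply filter_imp. intros s Hs.
      now apply (rate_defect_Scheffe p q M i s Hc Hq Hs).
    - intros k. apply (filterlim_Rabs_lt (at_right 0)). intros e Hpos.
      generalize (proj1 (filterlim_Rabs_lt (at_right 0) _ _) (proj2 Hc i k) e Hpos).
      apply filter_imp. intros s Hs. rewrite Rminus_0_r.
      rewrite Rabs_pos_eq by apply Rmax_l. apply Rabs_lt_between in Hs.
      apply Rmax_lub_lt; lra. }
  rewrite Series_0 in Hlim.
  generalize (filter_and (F := at_right 0) _ _ at_right_0_pos
    (proj1 (filterlim_Rabs_lt (at_right 0) _ _) Hlim (eps / 2) ltac:(lra))).
  apply filter_imp. intros s [Hs Hl].
  destruct (rate_defect_Scheffe p q M i s Hc Hq Hs) as (_ & _ & ->).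
  rewrite Rminus_0_r in Hl |- *. rewrite Rabs_mult, (Rabs_pos_eq 2) by lra. lra.
Qed.

(** * Differentiating the flow of a summable row vector *)

(** A right derivative on the half-line that is uniform in time: nothing is
    known for [t < 0], and uniformity replaces the regularity that would recover
    [f] from a pointwise one-sided derivative. *)
Definition uniform_derivative (f w : R -> R) : Prop :=
  forall eps, 0 < eps -> exists delta, 0 < delta /\
  forall t s, 0 <= t -> 0 < s < delta -> Rabs (f (t + s) - f t - s * w t) <= eps * s.

(** Cut [[0, t]] into steps shorter than [delta] and add up the increments. *)
Lemma uniform_derivative_0 f :
  uniform_derivative f (fun _ => 0) -> forall t, 0 <= t -> f t = f 0.
Proof.
  intros H t Ht.
  assert (Hb : forall eps, 0 < eps -> Rabs (f t - f 0) <= eps * t).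
  { intros eps He. destruct (H eps He) as (d & Hd & Hf).
    destruct Ht as [Ht| <-]; [|rewrite Rminus_diag, Rabs_R0; lra].
    (* The step t / N is shorter than the d of the derivative estimate. *)
    destruct (archimed_cor1 (d / t)) as [N [HN HN0]]; [now apply Rdiv_lt_0_compat|].
    assert (HNr : 0 < INR N) by now apply lt_0_INR.
    assert (Hs : 0 < t / INR N < d).
    { split; [now apply Rdiv_lt_0_compat|].
      replace d with (t * (d / t)) by (field; lra). now apply Rmult_lt_compat_l. }
    assert (Hk : forall k, Rabs (f (INR k * (t / INR N)) - f 0)
                           <= eps * (INR k * (t / INR N))).
    { induction k as [|k IH].
      - simpl. rewrite Rmult_0_l, Rminus_diag, Rabs_R0. lra.
      - assert (Hk0 : 0 <= INR k * (t / INR N)) by (apply Rmult_le_pos; [apply pos_INR|lra]).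
        specialize (Hf (INR k * (t / INR N)) (t / INR N) Hk0 Hs).
        rewrite S_INR. replace ((INR k + 1) * (t / INR N))
          with (INR k * (t / INR N) + t / INR N) by ring.
        rewrite Rmult_0_r, Rminus_0_r in Hf.
        apply Rabs_le_between in Hf, IH. apply Rabs_le. lra. }
    specialize (Hk N). replace (INR N * (t / INR N)) with t in Hk by (field; lra).
    assumption. }
  apply Rminus_diag_uniq. apply Rabs_eq_0. apply Rle_antisym; [|apply Rabs_pos].
  apply Rnot_lt_le. intros Hlt.
  assert (Ht' : 0 < t + 1) by lra.
  assert (He : 0 < Rabs (f t - f 0) / (t + 1)) by now apply Rdiv_lt_0_compat.
  specialize (Hb _ He).
  assert (Rabs (f t - f 0) / (t + 1) * (t + 1) = Rabs (f t - f 0)) by (field; lra).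
  lra.
Qed.

(** The Chapman-Kolmogorov equation factors the increment as
    [(P(s) - I - s Q) P(t)], and the entries of [P(t)] are at most one; the
    bound does not depend on [t]. *)
Lemma transition_increment p q M i j t s :
  is_chain q p -> bounded_generator q M -> 0 <= t -> 0 < s ->
  Rabs (p (t + s) i j - p t i j - s * Series (fun k => q i k * p t k j))
    <= s * rate_defect p q i s.
Proof.
  intros Hc Hq Ht Hs. pose proof (proj1 Hc) as Hp.
  assert (Hck := tf_chapman_kolmogorov p Hp s t i j (Rlt_le _ _ Hs) Ht).
  rewrite (Rplus_comm t s).
  assert (Hqp : ex_series (fun k => q i k * p t k j)).
  { apply (ex_series_l1_mult _ _ 1).
    - eexists. now apply (bg_row_abs q M).
    - intros k. now apply tf_Rabs_le1. }
  assert (Hd : is_series (fun k => s * (((p s i k - kron i k) / s - q i k) * p t k j))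
    (p (s + t) i j - p t i j - s * Series (fun k => q i k * p t k j))).
  { eapply is_series_Rext; [|eapply is_series_value; [
      apply is_series_Rplus; [apply is_series_Rplus; [exact Hck|
        exact (is_series_Rmult (-1) _ _ (is_series_kron (fun k => p t k j) i))]|
        exact (is_series_Rmult (- s) _ _ (Series_Rcorrect _ Hqp))]|]].
    - intros k. cbv beta. field. lra.
    - ring. }
  rewrite <- (is_series_unique _ _ Hd), Series_scal_l, Rabs_mult, (Rabs_pos_eq s) by lra.
  apply Rmult_le_compat_l; [lra|].
  apply Series_dominated; [|now apply (rate_defect_Scheffe p q M)].
  intros k. rewrite Rabs_mult. rewrite <- (Rmult_1_r (Rabs ((_ - _) / _ - _))) at 2.
  apply Rmult_le_compat_l; [apply Rabs_pos|]. now apply tf_Rabs_le1.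
Qed.

(** Sum [transition_increment] against [x]: the total error is [s] times
    the series of [|x_i| rate_defect_i(s)], which vanishes as [s -> 0] by dominated
    convergence. *)
Lemma flow_derivative p q M x j :
  is_chain q p -> bounded_generator q M -> l1 x ->
  uniform_derivative (fun t => vmul x (p t) j) (fun t => vmul (vmul x q) (p t) j).
Proof.
  intros Hc Hq Hx. pose proof (proj1 Hc) as Hp. intros eps He.
  assert (Hlim : filterlim (fun s => Series (fun i => Rabs (x i) * rate_defect p q i s))
    (at_right 0) (locally (Series (fun i => Rabs (x i) * 0)))).
  { apply (dominated_convergence_series (at_right 0))
      with (g := fun i => 4 * M * Rabs (x i)).
    - now apply ex_series_Rmult.
    - intros i. rewrite Rmult_0_r, Rabs_R0.
      apply Rmult_le_pos; [|apply Rabs_pos].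
      destruct (rate_defect_bound p q M i 1 Hc Hq Rlt_0_1). lra.
    - generalize at_right_0_pos. apply filter_imp. intros s Hs i.
      assert (H := rate_defect_bound p q M i s Hc Hq Hs).
      rewrite Rabs_mult, Rabs_Rabsolu, (Rabs_pos_eq (rate_defect _ _ _ _)) by apply H.
      rewrite Rmult_comm. apply Rmult_le_compat_r; [apply Rabs_pos|apply H].
    - intros i.
      exact (filterlim_comp _ _ _ _ _ _ _ _ (rate_defect_lim p q M i Hc Hq)
        (filterlim_scal_r (Rabs (x i)) (0 : R_NormedModule))). }
  rewrite Series_scal_r, Rmult_0_r in Hlim.
  destruct (proj1 (filterlim_Rabs_lt (at_right 0) _ _) Hlim eps He) as [d Hd].
  exists d. split; [apply d|]. intros t s Ht [Hs Hsd].
  specialize (Hd s). cbv beta in Hd.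
  assert (Hs' : Rabs (Series (fun i => Rabs (x i) * rate_defect p q i s) - 0) < eps).
  { apply Hd; [|assumption].
    unfold ball; simpl; unfold AbsRing_ball, minus, plus, opp, abs; simpl.
    rewrite Ropp_0, Rplus_0_r, Rabs_pos_eq; lra. }
  clear Hd. rewrite Rminus_0_r in Hs'.
  assert (Hw : vmul (vmul x q) (p t) j
               = Series (fun i => x i * Series (fun k => q i k * p t k j))).
  { apply is_series_unique. apply (vmul_assoc _ _ _ (2 * M) 1 Hx).
    - now apply bg_rows_bounded.
    - intros k. now apply tf_Rabs_le1. }
  rewrite Hw. unfold vmul.
  assert (E1 : ex_series (fun i => x i * p (t + s) i j)).
  { apply (ex_series_l1_mult _ _ 1 Hx). intros i. apply tf_Rabs_le1; [assumption|lra]. }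
  assert (E2 : ex_series (fun i => x i * p t i j)).
  { apply (ex_series_l1_mult _ _ 1 Hx). intros i. now apply tf_Rabs_le1. }
  assert (E3 : ex_series (fun i => x i * Series (fun k => q i k * p t k j))).
  { apply (ex_series_l1_mult _ _ (2 * M) Hx). intros i.
    destruct (bg_rows_bounded q M Hq i) as [H1 H2]. eapply Rle_trans; [|exact H2].
    apply Series_dominated; [|assumption]. intros k. rewrite Rabs_mult.
    rewrite <- (Rmult_1_r (Rabs (q i k))) at 2.
    apply Rmult_le_compat_l; [apply Rabs_pos|]. now apply tf_Rabs_le1. }
  rewrite <- Series_scal_l, <- Series_minus by assumption.
  rewrite <- Series_minus; [|now apply ex_series_Rminus|now apply ex_series_Rmult].
  apply Rle_trans with (Series (fun i => s * (Rabs (x i) * rate_defect p q i s))).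
  - apply Series_dominated.
    + intros i.
      replace (x i * p (t + s) i j - x i * p t i j
               - s * (x i * Series (fun k => q i k * p t k j)))
        with (x i * (p (t + s) i j - p t i j - s * Series (fun k => q i k * p t k j)))
        by ring.
      rewrite Rabs_mult.
      replace (s * (Rabs (x i) * rate_defect p q i s))
        with (Rabs (x i) * (s * rate_defect p q i s)) by ring.
      apply Rmult_le_compat_l; [apply Rabs_pos|]. now apply (transition_increment p q M).
    + apply ex_series_Rmult.
      apply (ex_series_l1_mult _ _ (4 * M)).
      * unfold l1. eapply ex_series_Rext; [|exact Hx]. intros n. now rewrite Rabs_Rabsolu.
      * intros i. assert (H := rate_defect_bound p q M i s Hc Hq Hs).
        rewrite Rabs_pos_eq; apply H.
  - rewrite Series_scal_l, (Rmult_comm eps). apply Rmult_le_compat_l; [lra|].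
    apply Rabs_lt_between in Hs'. lra.
Qed.

Lemma vmul_init p x j : is_transition_function p -> vmul x (p 0) j = x j.
Proof.
  intros H. apply is_series_unique.
  eapply is_series_Rext; [|exact (is_series_kron x j)].
  intros i. cbv beta. rewrite (tf_init p H). unfold kron.
  rewrite (Nat.eqb_sym i j). ring.
Qed.

Lemma uniform_derivative_ext f g v w :
  (forall t, 0 <= t -> f t = g t) -> (forall t, 0 <= t -> v t = w t) ->
  uniform_derivative f v -> uniform_derivative g w.
Proof.
  intros Hf Hv H eps He. destruct (H eps He) as (d & Hd & Hb).
  exists d. split; [assumption|]. intros t s Ht Hs.
  rewrite <- !Hf, <- Hv by lra. now apply Hb.
Qed.

(** The flow of [pi] is constant exactly when its derivative [(pi Q) P(t)]
    vanishes; at [t = 0] this derivative is [pi Q]. *)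
Lemma invariant_iff p q M x :
  is_chain q p -> bounded_generator q M -> l1 x ->
  (forall t j, 0 <= t -> is_series (fun i => x i * p t i j) (x j)) <->
  (forall j, vmul x q j = 0).
Proof.
  intros Hc Hq Hx. pose proof (proj1 Hc) as Hp. split.
  - intros Hinv j. assert (Hd := flow_derivative p q M x j Hc Hq Hx).
    assert (Hb : forall eps, 0 < eps -> Rabs (vmul x q j) <= eps).
    { intros eps He. destruct (Hd eps He) as (d & Hd0 & Hb).
      specialize (Hb 0 (d / 2) (Rle_refl 0) ltac:(lra)).
      unfold vmul at 1 2 in Hb.
      rewrite (is_series_unique _ _ (Hinv (0 + d / 2) j ltac:(lra))) in Hb.
      rewrite (is_series_unique _ _ (Hinv 0 j (Rle_refl 0))) in Hb.
      rewrite vmul_init in Hb by assumption.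
      replace (x j - x j - d / 2 * vmul x q j) with (- (d / 2 * vmul x q j)) in Hb by ring.
      rewrite Rabs_Ropp, Rabs_mult, (Rabs_pos_eq (d / 2)), (Rmult_comm eps) in Hb by lra.
      apply (Rmult_le_reg_l (d / 2)); lra. }
    apply Rabs_eq_0. apply Rle_antisym; [|apply Rabs_pos].
    apply Rnot_lt_le. intros Hlt. specialize (Hb (Rabs (vmul x q j) / 2) ltac:(lra)). lra.
  - intros H0 t j Ht.
    assert (Hconst : vmul x (p t) j = vmul x (p 0) j).
    { apply (uniform_derivative_0 (fun t => vmul x (p t) j)); [|assumption].
      eapply uniform_derivative_ext; [| |apply (flow_derivative p q M x j Hc Hq Hx)].
      - reflexivity.
      - intros s Hs. unfold vmul at 1. rewrite (Series_ext _ (fun i => 0 * p s i j)).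
        + rewrite Series_scal_l. ring.
        + intros i. now rewrite H0. }
    rewrite vmul_init in Hconst by assumption.
    eapply is_series_value; [|exact Hconst]. apply Series_Rcorrect.
    apply (ex_series_l1_mult _ _ 1 Hx). intros i. now apply tf_Rabs_le1.
Qed.

(** * Existence of a stationary distribution *)

(** Uniformisation with a reset.  For [Lam] large,
    [I + Q / Lam = K + theta (1 e_0)] where [K] is nonnegative with row sums
    [1 - theta], so [pi = pi (I + Q / Lam)] means [pi = theta e_0 + pi K], solved by
    [pi = theta (e_0 + e_0 K + e_0 K^2 + ...)]. *)
Lemma stationary_exists q M beta :
  bounded_generator q M -> 0 < beta -> (forall i, (1 <= i)%nat -> beta <= q i 0%nat) ->
  exists pi : nat -> R, (forall j, 0 <= pi j) /\ is_series pi 1 /\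
    forall j, vmul pi q j = 0.
Proof.
  intros Hq Hbeta Hcat.
  assert (HM : 0 <= M).
  { assert (H := bg_bound q M Hq 0%nat).
    assert (H' := is_series_unique _ _ (bg_row_abs q M 0 Hq)).
    assert (0 <= Series (fun k => Rabs (q 0%nat k))); [|lra].
    apply Series_nonneg; [intros; apply Rabs_pos|]. eexists. now apply (bg_row_abs q M). }
  (* Rate Lam = M + beta leaves room on the diagonal for removing the reset at 0. *)
  set (Lam := M + beta). assert (HLam : 0 < Lam) by (unfold Lam; lra).
  set (theta := beta / Lam).
  assert (Hth : 0 < theta) by now apply Rdiv_lt_0_compat.
  assert (Hth1 : theta <= 1).
  { unfold theta. apply Rle_div_l; [assumption|]. unfold Lam. lra. }
  set (K := fun i j => kron i j + / Lam * q i j + - theta * kron 0 j).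
  assert (HiL : 0 < / Lam) by now apply Rinv_0_lt_compat.
  assert (HLt : / Lam * beta = theta) by (unfold theta, Rdiv; ring).
  assert (HLM : 1 - / Lam * M = theta) by (unfold theta, Lam; field; fold Lam; lra).
  assert (HK0 : forall i j, 0 <= K i j).
  { intros i j. unfold K.
    assert (Hdiag : 0 <= 1 + / Lam * q i i + - theta).
    { assert (H := bg_bound q M Hq i).
      apply (Rmult_le_compat_l (/ Lam)) in H; lra. }
    destruct (Nat.eq_dec i j) as [<-|Hij].
    - rewrite kron_refl. destruct (Nat.eq_dec 0 i) as [<-|Hi].
      + rewrite kron_refl. lra.
      + rewrite (kron_neq 0 i Hi). lra.
    - rewrite (kron_neq i j Hij). destruct (Nat.eq_dec 0 j) as [<-|Hj].
      + rewrite kron_refl. specialize (Hcat i ltac:(lia)).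
        apply (Rmult_le_compat_l (/ Lam)) in Hcat; lra.
      + rewrite (kron_neq 0 j Hj). assert (H := bg_off q M Hq i j Hij).
        assert (0 <= / Lam * q i j) by (apply Rmult_le_pos; lra). lra. }
  assert (HKrow : forall i, is_series (K i) (1 - theta)).
  { intros i. eapply is_series_value; [apply is_series_Rplus; [apply is_series_Rplus;
      [apply is_series_kron1|apply is_series_Rmult; apply (bg_row q M Hq)]|
      apply is_series_Rmult; apply is_series_kron1]|]. ring. }
  assert (HKb : rows_bounded K 1).
  { intros i. assert (H : is_series (fun k => Rabs (K i k)) (1 - theta)).
    { eapply is_series_Rext; [|apply HKrow]. intros k. cbv beta.
      now rewrite Rabs_pos_eq. }
    split; [eexists; eassumption|]. rewrite (is_series_unique _ _ H). lra. }
  set (z := fix z (n : nat) : nat -> R :=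
    match n with O => kron 0 | S m => vmul (z m) K end).
  assert (Hz : forall n, (forall j, 0 <= z n j) /\ is_series (z n) ((1 - theta) ^ n)).
  { induction n as [|n [IH1 IH2]].
    - split; [intros; apply kron_ge0|apply is_series_kron1].
    - assert (Hl1 : l1 (z n)).
      { unfold l1. eapply ex_series_Rext; [|eexists; exact IH2].
        intros k. symmetry. now apply Rabs_pos_eq. }
      split.
      + intros j. simpl. apply Series_nonneg.
        * intros i. now apply Rmult_le_pos.
        * apply (ex_series_l1_mult _ _ 1 Hl1). intros i.
          now apply (rows_bounded_entry K).
      + eapply is_series_Rext; [|eapply is_series_value;
          [apply (vmul_assoc (z n) K (fun _ => 1) 1 1 Hl1 HKb)|]].
        * intros k. simpl. ring.
        * intros k. rewrite Rabs_R1. lra.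
        * rewrite (Series_ext _ (fun i => (1 - theta) * z n i)).
          -- rewrite Series_scal_l, (is_series_unique _ _ IH2). reflexivity.
          -- intros i. rewrite Series_scal_r, (is_series_unique _ _ (HKrow i)). ring. }
  assert (Habs : Rabs (1 - theta) < 1) by (apply Rabs_lt_between; lra).
  assert (Hgeom : ex_series (fun n => (1 - theta) ^ n)) by now apply ex_series_geom.
  assert (Hzabs : forall n, is_series (fun k => Rabs (z n k)) ((1 - theta) ^ n)).
  { intros n. eapply is_series_Rext; [|apply (proj2 (Hz n))].
    intros k. symmetry. apply Rabs_pos_eq. apply Hz. }
  assert (Hzj : forall n j, Rabs (z n j) <= (1 - theta) ^ n).
  { intros n j. rewrite <- (is_series_unique _ _ (Hzabs n)).
    apply (term_le_Series (fun k => Rabs (z n k))); [intros; apply Rabs_pos|].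
    eexists; apply Hzabs. }
  assert (Hzex : forall j, ex_series (fun n => z n j)).
  { intros j. apply (ex_series_dominated _ (fun n => (1 - theta) ^ n)); [|assumption].
    intros n. apply Hzj. }
  set (pi := fun j => theta * Series (fun n => z n j)).
  assert (Hpi0 : forall j, 0 <= pi j).
  { intros j. apply Rmult_le_pos; [lra|]. apply Series_nonneg; [|apply Hzex].
    intros n. apply Hz. }
  assert (Hpi1 : is_series pi 1).
  { eapply is_series_value; [apply is_series_Rmult;
      apply (Series_Fubini z (fun n => (1 - theta) ^ n) Hgeom)|].
    - intros n. eexists; apply Hzabs.
    - intros n. rewrite (is_series_unique _ _ (Hzabs n)). lra.
    - rewrite (Series_ext _ (fun n => (1 - theta) ^ n)).
      + rewrite Series_geom by assumption. field. lra.
      + intros n. apply is_series_unique, Hz. }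
  assert (Hpil1 : l1 pi).
  { unfold l1. eapply ex_series_Rext; [|eexists; exact Hpi1].
    intros k. symmetry. now apply Rabs_pos_eq. }
  exists pi. split; [exact Hpi0|]. split; [exact Hpi1|]. intros j.
  assert (HpiK : is_series (fun i => pi i * K i j) (pi j - theta * kron 0 j)).
  { eapply is_series_Rext; [|eapply is_series_value; [apply (is_series_Rmult theta);
      apply (Series_Fubini (fun n i => z n i * K i j) (fun n => (1 - theta) ^ n) Hgeom)|]].
    - intros i. cbv beta. unfold pi. rewrite Series_scal_r. ring.
    - intros n. apply (ex_series_dominated _ (fun k => Rabs (z n k))).
      + intros k. rewrite Rabs_Rabsolu, Rabs_mult.
        rewrite <- (Rmult_1_r (Rabs (z n k))) at 2.
        apply Rmult_le_compat_l; [apply Rabs_pos|now apply rows_bounded_entry].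
      + eexists; apply Hzabs.
    - intros n. rewrite <- (is_series_unique _ _ (Hzabs n)). apply Series_le.
      + intros k. split; [apply Rabs_pos|]. rewrite Rabs_mult.
        rewrite <- (Rmult_1_r (Rabs (z n k))) at 2.
        apply Rmult_le_compat_l; [apply Rabs_pos|now apply rows_bounded_entry].
      + eexists; apply Hzabs.
    - change (theta * Series (fun n => z (S n) j) = pi j - theta * kron 0 j).
      unfold pi. rewrite (Series_incr_1 (fun n => z n j)) by apply Hzex.
      simpl (z 0%nat j). ring. }
  apply is_series_unique.
  eapply is_series_Rext; [|eapply is_series_value; [
    apply (is_series_Rmult Lam); apply is_series_Rplus; [apply is_series_Rplus;
      [exact HpiK|exact (is_series_Rmult (-1) _ _ (is_series_kron pi j))]|
      exact (is_series_Rmult (theta * kron 0 j) _ _ Hpi1)]|]].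
  - intros i. cbv beta. unfold K.
    replace (kron j i) with (kron i j) by (unfold kron; now rewrite Nat.eqb_sym).
    field. lra.
  - ring.
Qed.

(** * The resolvent equation *)

(** Uniformity in [i] is what allows a sum over initial states of integrals over
    time to be differentiated term by term. *)
Lemma transition_Lipschitz p q M i j t s :
  is_chain q p -> bounded_generator q M -> 0 <= t -> 0 <= s ->
  Rabs (p (t + s) i j - p t i j) <= 6 * M * s.
Proof.
  intros Hc Hq Ht [Hs| <-].
  2:{ rewrite Rplus_0_r, Rminus_diag, Rabs_R0. lra. }
  assert (H := transition_increment p q M i j t s Hc Hq Ht Hs).
  assert (Hr := rate_defect_bound p q M i s Hc Hq Hs).
  assert (Hw : Rabs (Series (fun k => q i k * p t k j)) <= 2 * M).
  { destruct (bg_rows_bounded q M Hq i) as [H1 H2]. eapply Rle_trans; [|exact H2].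
    apply Series_dominated; [|assumption]. intros k. rewrite Rabs_mult.
    rewrite <- (Rmult_1_r (Rabs (q i k))) at 2.
    apply Rmult_le_compat_l; [apply Rabs_pos|]. apply tf_Rabs_le1; [apply Hc|assumption]. }
  set (w := Series _) in *. set (r := rate_defect p q i s) in *.
  apply (Rmult_le_compat_l s) in Hw; [|lra].
  assert (Hr' : s * r <= s * (4 * M)) by (apply Rmult_le_compat_l; lra).
  assert (Hsw : Rabs (s * w) <= s * (2 * M)) by (rewrite Rabs_mult, (Rabs_pos_eq s); lra).
  apply Rabs_le_between in H, Hsw. apply Rabs_le. lra.
Qed.

Lemma exp_neg_bounds y : 0 <= y -> 0 <= exp (- y) - 1 + y <= y * y.
Proof.
  intros Hy. split.
  - assert (H := exp_ineq1_le (- y)). lra.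
  - rewrite exp_Ropp. assert (H := exp_ineq1_le y).
    assert (/ exp y <= / (1 + y)) by (apply Rinv_le_contravar; lra).
    assert (/ (1 + y) - 1 + y <= y * y); [|lra].
    replace (/ (1 + y) - 1 + y) with (y * y * / (1 + y)) by (field; lra).
    rewrite <- (Rmult_1_r (y * y)) at 2. apply Rmult_le_compat_l; [nra|].
    rewrite <- Rinv_1. apply Rinv_le_contravar; lra.
Qed.

Lemma exp_neg_le1 y : 0 <= y -> 0 <= exp (- y) <= 1.
Proof.
  intros Hy. split; [left; apply exp_pos|]. rewrite <- exp_0.
  destruct Hy as [Hy| <-]; [left; apply exp_increasing; lra|right; f_equal; lra].
Qed.

Lemma exp_neg_plus lambda t s :
  exp (- lambda * (t + s)) = exp (- lambda * t) * exp (- (lambda * s)).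
Proof. rewrite <- exp_plus. f_equal. ring. Qed.

Lemma discounted_Lipschitz p q M lambda i j t s :
  is_chain q p -> bounded_generator q M -> 0 < lambda -> 0 <= t -> 0 <= s ->
  Rabs (exp (- lambda * (t + s)) * p (t + s) i j - exp (- lambda * t) * p t i j)
    <= (lambda + 6 * M) * s.
Proof.
  intros Hc Hq Hl Ht Hs.
  assert (Hls : 0 <= lambda * s) by (apply Rmult_le_pos; lra).
  assert (Hlt : 0 <= lambda * t) by (apply Rmult_le_pos; lra).
  assert (H1 := transition_Lipschitz p q M i j t s Hc Hq Ht Hs).
  assert (H2 := exp_neg_bounds _ Hls).
  assert (H3 := exp_neg_le1 _ Hls).
  assert (H4 := exp_neg_le1 _ Hlt).
  assert (Hp := tf_ge0 p (proj1 Hc) t i j Ht).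
  assert (Hp1 := tf_le1 p t i j (proj1 Hc) Ht).
  rewrite exp_neg_plus.
  replace (- lambda * t) with (- (lambda * t)) by ring.
  set (e := exp (- (lambda * t))) in *. set (d := exp (- (lambda * s))) in *.
  replace (e * d * p (t + s) i j - e * p t i j)
    with ((e * d) * (p (t + s) i j - p t i j) + (e * p t i j) * (d - 1)) by ring.
  eapply Rle_trans; [apply Rabs_triang|]. rewrite !Rabs_mult.
  rewrite (Rabs_pos_eq e), (Rabs_pos_eq d), (Rabs_pos_eq (p t i j)), (Rabs_left1 (d - 1))
    by lra.
  assert (e * d <= 1) by nra. assert (e * p t i j <= 1) by nra.
  assert (0 <= e * d) by nra. assert (0 <= e * p t i j) by nra.
  assert (H9 := Rabs_pos (p (t + s) i j - p t i j)).
  nra.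
Qed.

Definition Lipschitz_on_nonneg (f : R -> R) (L : R) : Prop :=
  forall t s, 0 <= t -> 0 <= s -> Rabs (f (t + s) - f t) <= L * s.

(** Continuity is known only on the half-line, so the integrand is first frozen
    at its value at [0] for negative arguments. *)
Lemma Lipschitz_ex_RInt f L a b :
  Lipschitz_on_nonneg f L -> 0 <= a <= b -> ex_RInt f a b.
Proof.
  intros HL [Ha Hab].
  apply (ex_RInt_ext (fun t => f (Rmax 0 t))).
  { intros t Ht. rewrite Rmin_left, Rmax_right in Ht by lra. f_equal.
    apply Rmax_right. lra. }
  apply (ex_RInt_continuous (V := R_CompleteNormedModule)). intros t _.
  assert (HL0 : 0 <= L).
  { specialize (HL 0 1 ltac:(lra) ltac:(lra)). rewrite Rmult_1_r in HL.
    eapply Rle_trans; [apply Rabs_pos|exact HL]. }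
  assert (Hb : forall u v, u <= v -> Rabs (f (Rmax 0 v) - f (Rmax 0 u)) <= L * (v - u)).
  { intros u v Huv.
    assert (H1 : 0 <= Rmax 0 u) by apply Rmax_l.
    assert (H2 : 0 <= Rmax 0 v - Rmax 0 u <= v - u).
    { unfold Rmax. destruct (Rle_dec 0 u), (Rle_dec 0 v); lra. }
    specialize (HL (Rmax 0 u) (Rmax 0 v - Rmax 0 u) H1 (proj1 H2)).
    replace (Rmax 0 u + (Rmax 0 v - Rmax 0 u)) with (Rmax 0 v) in HL by ring.
    eapply Rle_trans; [exact HL|]. apply Rmult_le_compat_l; lra. }
  apply (filterlim_Rabs_lt (locally t)). intros eps He.
  assert (Hd : 0 < eps / (L + 1)) by (apply Rdiv_lt_0_compat; lra).
  exists (mkposreal _ Hd). intros u Hu.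
  change (Rabs (u - t) < eps / (L + 1)) in Hu.
  assert (Hbd : Rabs (f (Rmax 0 u) - f (Rmax 0 t)) <= L * Rabs (u - t)).
  { destruct (Rle_dec t u) as [Htu|Htu].
    - rewrite (Rabs_pos_eq (u - t)) by lra. now apply Hb.
    - rewrite (Rabs_left1 (u - t)), Rabs_minus_sym by lra.
      replace (- (u - t)) with (t - u) by ring. apply Hb. lra. }
  assert (Hm : (L + 1) * Rabs (u - t) < (L + 1) * (eps / (L + 1)))
    by (apply Rmult_lt_compat_l; lra).
  replace ((L + 1) * (eps / (L + 1))) with eps in Hm by (field; lra).
  assert (Hpos := Rabs_pos (u - t)). lra.
Qed.

Lemma Lipschitz_RInt_step f L t s :
  Lipschitz_on_nonneg f L -> 0 <= t -> 0 <= s ->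
  Rabs (RInt f 0 (t + s) - RInt f 0 t - s * f t) <= L * s * s.
Proof.
  intros HL Ht Hs.
  assert (HL0 : 0 <= L * s).
  { specialize (HL 0 s ltac:(lra) Hs). eapply Rle_trans; [apply Rabs_pos|exact HL]. }
  assert (E1 : ex_RInt f 0 t) by (apply (Lipschitz_ex_RInt f L); [assumption|lra]).
  assert (E2 : ex_RInt f t (t + s)) by (apply (Lipschitz_ex_RInt f L); [assumption|lra]).
  assert (HC := RInt_Chasles f 0 t (t + s) E1 E2).
  change (RInt f 0 t + RInt f t (t + s) = RInt f 0 (t + s)) in HC.
  assert (E3 : ex_RInt (fun _ => f t) t (t + s)) by apply ex_RInt_const.
  assert (HM := RInt_minus f (fun _ => f t) t (t + s) E2 E3).
  rewrite RInt_const in HM.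
  change (RInt (fun x => f x - f t) t (t + s)
          = RInt f t (t + s) - (t + s - t) * f t) in HM.
  replace (RInt f 0 (t + s) - RInt f 0 t - s * f t)
    with (RInt (fun x => f x - f t) t (t + s)) by lra.
  replace (L * s * s) with ((t + s - t) * (L * s)) by ring.
  apply abs_RInt_le_const; [lra|now apply (ex_RInt_minus f (fun _ => f t))|].
  intros x Hx. specialize (HL t (x - t) Ht ltac:(lra)).
  replace (t + (x - t)) with x in HL by ring.
  eapply Rle_trans; [exact HL|].
  assert (0 <= L * (x - t)) by (eapply Rle_trans; [apply Rabs_pos|exact HL]).
  destruct (Req_dec s 0) as [->|Hs0].
  { replace (x - t) with 0 by lra. lra. }
  apply Rmult_le_compat_l; [|lra].
  apply Rnot_lt_le. intros Hneg. assert (0 < s) by lra. nra.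
Qed.

Lemma is_RInt_exp_neg lambda T :
  0 < lambda -> is_RInt (fun t => exp (- lambda * t)) 0 T ((1 - exp (- lambda * T)) / lambda).
Proof.
  intros Hl.
  replace ((1 - exp (- lambda * T)) / lambda)
    with (minus (- exp (- lambda * T) / lambda) (- exp (- lambda * 0) / lambda)).
  2:{ rewrite Rmult_0_r, exp_0. unfold minus, plus, opp; simpl. field. lra. }
  apply (is_RInt_derive (fun t => - exp (- lambda * t) / lambda)).
  - intros x _. auto_derive; [trivial|]. field. lra.
  - intros x _. apply (ex_derive_continuous (fun t => exp (- lambda * t))).
    auto_derive. trivial.
Qed.

(** The integrals over [[0, T]] increase to their supremum, which is then the
    improper integral. *)
Lemma RInt_gen_monotone_limit f C :
  (forall a b, 0 <= a <= b -> ex_RInt f a b) -> (forall t, 0 <= t -> 0 <= f t) ->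
  (forall T, 0 <= T -> RInt f 0 T <= C) ->
  filterlim (fun T => RInt f 0 T) (Rbar_locally p_infty)
    (locally (RInt_gen f (at_point 0) (Rbar_locally p_infty))).
Proof.
  intros Hex Hf HC.
  assert (Hmono : forall a b, 0 <= a <= b -> RInt f 0 a <= RInt f 0 b).
  { intros a b Hab.
    assert (HCh := RInt_Chasles f 0 a b (Hex 0 a ltac:(lra)) (Hex a b Hab)).
    change (RInt f 0 a + RInt f a b = RInt f 0 b) in HCh.
    assert (0 <= RInt f a b); [|lra].
    apply RInt_ge_0; [lra|now apply Hex|]. intros x Hx. apply Hf. lra. }
  destruct (completeness (fun y => exists T, 0 <= T /\ y = RInt f 0 T)) as [l [Hub Hlub]].
  { exists C. intros y (T & HT & ->). now apply HC. }
  { exists (RInt f 0 0), 0. split; [lra|reflexivity]. }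
  assert (Hlim : filterlim (fun T => RInt f 0 T) (Rbar_locally p_infty) (locally l)).
  { apply (filterlim_Rabs_lt (Rbar_locally p_infty)). intros eps He.
    assert (Hex' : exists T, 0 <= T /\ l - eps < RInt f 0 T).
    { destruct (Classical_Prop.classic (exists T, 0 <= T /\ l - eps < RInt f 0 T))
        as [H|H]; [exact H|exfalso].
      assert (l <= l - eps); [|lra]. apply Hlub. intros y (T & HT & ->).
      apply Rnot_lt_le. intros Hlt. apply H. now exists T. }
    destruct Hex' as (T & HT & HTl). exists T. intros x Hx.
    assert (RInt f 0 T <= RInt f 0 x) by (apply Hmono; lra).
    assert (RInt f 0 x <= l) by (apply Hub; exists x; split; [lra|reflexivity]).
    apply Rabs_lt_between. lra. }
  assert (Hgen : is_RInt_gen f (at_point 0) (Rbar_locally p_infty) l).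
  { intros P HP.
    apply (Filter_prod _ _ _ (fun a => a = 0)
      (fun b => 0 < b /\ P (RInt f 0 b))).
    - reflexivity.
    - apply filter_and; [now exists 0|exact (Hlim P HP)].
    - intros a b -> [Hb HPb]. exists (RInt f 0 b). split; [|assumption].
      apply (RInt_correct f), Hex. simpl. lra. }
  now rewrite (is_RInt_gen_unique f l Hgen).
Qed.

Lemma uniform_derivative_plus f g v w :
  uniform_derivative f v -> uniform_derivative g w ->
  uniform_derivative (fun t => f t + g t) (fun t => v t + w t).
Proof.
  intros Hf Hg eps He.
  destruct (Hf (eps / 2) ltac:(lra)) as (d1 & Hd1 & H1).
  destruct (Hg (eps / 2) ltac:(lra)) as (d2 & Hd2 & H2).
  exists (Rmin d1 d2). split; [now apply Rmin_pos|]. intros t s Ht [Hs Hsd].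
  assert (Ha := Rmin_l d1 d2). assert (Hb := Rmin_r d1 d2).
  specialize (H1 t s Ht ltac:(lra)). specialize (H2 t s Ht ltac:(lra)).
  apply Rabs_le_between in H1, H2. apply Rabs_le. lra.
Qed.

Lemma uniform_derivative_quadratic f w C :
  (forall t s, 0 <= t -> 0 < s -> Rabs (f (t + s) - f t - s * w t) <= C * s * s) ->
  uniform_derivative f w.
Proof.
  intros H eps He. assert (HC := Rabs_pos C).
  assert (Hd : 0 < eps / (Rabs C + 1)) by (apply Rdiv_lt_0_compat; lra).
  exists (eps / (Rabs C + 1)). split; [assumption|].
  intros t s Ht [Hs Hsd]. eapply Rle_trans; [now apply H|].
  apply Rmult_le_compat_r; [lra|].
  assert (Hm : (Rabs C + 1) * s < (Rabs C + 1) * (eps / (Rabs C + 1)))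
    by (apply Rmult_lt_compat_l; lra).
  replace ((Rabs C + 1) * (eps / (Rabs C + 1))) with eps in Hm by (field; lra).
  assert (C * s <= Rabs C * s) by (apply Rmult_le_compat_r; [lra|apply Rle_abs]). lra.
Qed.

(** The product rule for the factor [exp (- lambda t)], with remainder
    [exp (- y) - 1 + y <= y^2]. *)
Lemma uniform_derivative_discount f w lambda B :
  0 < lambda -> uniform_derivative f w ->
  (forall t, 0 <= t -> Rabs (f t) <= B) -> (forall t, 0 <= t -> Rabs (w t) <= B) ->
  uniform_derivative (fun t => exp (- lambda * t) * f t)
    (fun t => exp (- lambda * t) * (w t - lambda * f t)).
Proof.
  intros Hl Hf HB HW eps He.
  assert (HB0 : 0 <= B) by (eapply Rle_trans; [apply Rabs_pos|apply (HB 0); lra]).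
  set (C := B * lambda + B * (lambda * lambda)).
  assert (HC : 0 <= C) by (unfold C; apply Rplus_le_le_0_compat; repeat apply Rmult_le_pos; lra).
  destruct (Hf (eps / 2) ltac:(lra)) as (d & Hd & H1).
  assert (Hd2 : 0 < (eps / 2) / (C + 1)) by (apply Rdiv_lt_0_compat; lra).
  exists (Rmin d ((eps / 2) / (C + 1))). split; [now apply Rmin_pos|].
  intros t s Ht [Hs Hsd].
  assert (Ha := Rmin_l d ((eps / 2) / (C + 1))).
  assert (Hb := Rmin_r d ((eps / 2) / (C + 1))).
  specialize (H1 t s Ht ltac:(lra)). specialize (HB t Ht). specialize (HW t Ht).
  assert (Hm : (C + 1) * s < (C + 1) * ((eps / 2) / (C + 1)))
    by (apply Rmult_lt_compat_l; lra).
  replace ((C + 1) * ((eps / 2) / (C + 1))) with (eps / 2) in Hm by (field; lra).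
  assert (Hls : 0 <= lambda * s) by (apply Rmult_le_pos; lra).
  assert (Hlt : 0 <= lambda * t) by (apply Rmult_le_pos; lra).
  assert (E1 := exp_neg_bounds _ Hls). assert (E2 := exp_neg_le1 _ Hls).
  assert (E3 := exp_neg_le1 _ Hlt).
  rewrite exp_neg_plus. replace (- lambda * t) with (- (lambda * t)) by ring.
  set (e := exp (- (lambda * t))) in *. set (k := exp (- (lambda * s))) in *.
  set (a := f (t + s) - f t - s * w t) in *.
  replace (e * k * f (t + s) - e * f t - s * (e * (w t - lambda * f t)))
    with (e * (k * a + s * w t * (k - 1) + f t * (k - 1 + lambda * s)))
    by (unfold a; ring).
  rewrite Rabs_mult, (Rabs_pos_eq e) by lra.
  assert (Hin : Rabs (k * a + s * w t * (k - 1) + f t * (k - 1 + lambda * s)) <= eps * s).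
  { assert (A1 : Rabs (k * a) <= eps / 2 * s).
    { rewrite Rabs_mult, (Rabs_pos_eq k) by lra.
      assert (Hp := Rabs_pos a). nra. }
    assert (A2 : Rabs (s * w t * (k - 1)) <= B * lambda * s * s).
    { rewrite !Rabs_mult, (Rabs_pos_eq s), (Rabs_left1 (k - 1)) by lra.
      replace (B * lambda * s * s) with (s * B * (lambda * s)) by ring.
      apply Rmult_le_compat; [apply Rmult_le_pos; [lra|apply Rabs_pos]|lra| |lra].
      apply Rmult_le_compat_l; lra. }
    assert (A3 : Rabs (f t * (k - 1 + lambda * s)) <= B * (lambda * lambda) * s * s).
    { rewrite Rabs_mult, (Rabs_pos_eq (k - 1 + lambda * s)) by lra.
      replace (B * (lambda * lambda) * s * s) with (B * (lambda * s * (lambda * s))) by ring.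
      apply Rmult_le_compat; [apply Rabs_pos|lra|lra|lra]. }
    assert (A4 : C * s * s <= eps / 2 * s) by (apply Rmult_le_compat_r; lra).
    unfold C in A4.
    eapply Rle_trans; [apply Rabs_triang|].
    assert (A5 := Rabs_triang (k * a) (s * w t * (k - 1))). lra. }
  assert (Hp := Rabs_pos (k * a + s * w t * (k - 1) + f t * (k - 1 + lambda * s))).
  nra.
Qed.

Lemma resolvent_integral_bounds p q M lambda i j :
  is_chain q p -> bounded_generator q M -> 0 < lambda ->
  (forall T, 0 <= T ->
     Rabs (RInt (fun t => exp (- lambda * t) * p t i j) 0 T) <= / lambda) /\
  filterlim (fun T => RInt (fun t => exp (- lambda * t) * p t i j) 0 T)
    (Rbar_locally p_infty) (locally (resolvent p i j lambda)).
Proof.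
  intros Hc Hq Hl.
  set (v := fun t => exp (- lambda * t) * p t i j).
  assert (HL : Lipschitz_on_nonneg v (lambda + 6 * M)).
  { intros t s Ht Hs. now apply (discounted_Lipschitz p q M). }
  assert (Hv0 : forall t, 0 <= t -> 0 <= v t).
  { intros t Ht. apply Rmult_le_pos; [left; apply exp_pos|]. now apply (tf_ge0 p (proj1 Hc)). }
  assert (Hex : forall a b, 0 <= a <= b -> ex_RInt v a b).
  { intros a b Hab. now apply (Lipschitz_ex_RInt v _ a b HL). }
  assert (Hb : forall T, 0 <= T -> RInt v 0 T <= / lambda).
  { intros T HT.
    apply Rle_trans with (RInt (fun t => exp (- lambda * t)) 0 T).
    - apply RInt_le; [assumption|apply Hex; lra|eexists; now apply is_RInt_exp_neg|].
      intros x Hx. unfold v. rewrite <- (Rmult_1_r (exp _)) at 2.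
      apply Rmult_le_compat_l; [left; apply exp_pos|].
      apply tf_le1; [apply Hc|lra].
    - rewrite (is_RInt_unique _ _ _ _ (is_RInt_exp_neg lambda T Hl)).
      unfold Rdiv. rewrite <- (Rmult_1_l (/ lambda)) at 2.
      apply Rmult_le_compat_r; [left; now apply Rinv_0_lt_compat|].
      assert (H := exp_pos (- lambda * T)). lra. }
  split.
  - intros T HT. rewrite Rabs_pos_eq; [now apply Hb|].
    apply RInt_ge_0; [assumption|apply Hex; lra|]. intros x Hx. apply Hv0. lra.
  - exact (RInt_gen_monotone_limit v (/ lambda) Hex Hv0 Hb).
Qed.

Lemma exp_discount_lim lambda :
  0 < lambda -> filterlim (fun t => exp (- lambda * t)) (Rbar_locally p_infty) (locally 0).
Proof.
  intros Hl. apply (filterlim_Rabs_lt (Rbar_locally p_infty)). intros eps He.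
  exists (/ (lambda * eps)). intros t Ht.
  assert (Hle : 0 < lambda * eps) by now apply Rmult_lt_0_compat.
  assert (Ht0 : 0 < t) by (apply Rlt_trans with (/ (lambda * eps)); [now apply Rinv_0_lt_compat|exact Ht]).
  rewrite Rminus_0_r, Rabs_pos_eq by (left; apply exp_pos).
  replace (- lambda * t) with (- (lambda * t)) by ring. rewrite exp_Ropp.
  assert (H1 := exp_ineq1_le (lambda * t)).
  assert (H2 : 0 < lambda * t) by now apply Rmult_lt_0_compat.
  apply Rle_lt_trans with (/ (lambda * t)).
  - apply Rinv_le_contravar; lra.
  - rewrite <- (Rinv_inv eps). apply Rinv_lt_contravar.
    + apply Rmult_lt_0_compat; [now apply Rinv_0_lt_compat|assumption].
    + apply (Rmult_lt_compat_l lambda) in Ht; [|assumption].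
      replace (lambda * / (lambda * eps)) with (/ eps) in Ht by (field; lra). assumption.
Qed.

(** The function
    [exp (- lambda t) (x P(t))_j + sum_i g_i int_0^t exp (- lambda r) p_ij(r) dr],
    where [g = lambda x - x Q], has derivative zero, so it equals its initial
    value [x_j]; let [t] tend to infinity. *)
Lemma resolvent_equation p q M lambda x j :
  is_chain q p -> bounded_generator q M -> 0 < lambda -> l1 x ->
  is_series (fun i => (lambda * x i - vmul x q i) * resolvent p i j lambda) (x j).
Proof.
  intros Hc Hq Hl Hx. pose proof (proj1 Hc) as Hp.
  set (g := fun i => lambda * x i - vmul x q i).
  assert (Hxq : l1 (vmul x q)) by (apply (vmul_l1 x q (2 * M)); [assumption|now apply bg_rows_bounded]).
  assert (Hg : l1 g).
  { apply (ex_series_dominated _ (fun i => lambda * Rabs (x i) + Rabs (vmul x q i))).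
    - intros i. rewrite Rabs_Rabsolu. unfold g.
      rewrite <- (Rabs_pos_eq lambda) at 2 by lra. rewrite <- Rabs_mult.
      rewrite <- (Rabs_Ropp (vmul x q i)). apply Rabs_triang.
    - apply ex_series_Rplus; [now apply ex_series_Rmult|exact Hxq]. }
  set (I := fun i T => RInt (fun t => exp (- lambda * t) * p t i j) 0 T).
  assert (HI : forall i T, 0 <= T -> Rabs (I i T) <= / lambda).
  { intros i. apply (resolvent_integral_bounds p q M lambda i j Hc Hq Hl). }
  assert (Hvm : forall y t, l1 y -> 0 <= t -> ex_series (fun i => y i * p t i j)).
  { intros y t Hy Ht. apply (ex_series_l1_mult _ _ 1 Hy). intros i. now apply tf_Rabs_le1. }
  assert (Hgv : forall t, 0 <= t ->
    ex_series (fun i => g i * (exp (- lambda * t) * p t i j))).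
  { intros t Ht. eapply ex_series_Rext;
      [|exact (ex_series_Rmult (exp (- lambda * t)) _ (Hvm g t Hg Ht))].
    intros i. cbv beta. ring. }
  assert (HgI : forall t, 0 <= t -> ex_series (fun i => g i * I i t)).
  { intros t Ht. apply (ex_series_l1_mult _ _ (/ lambda) Hg). intros i. now apply HI. }
  assert (Hbd : forall y, l1 y -> exists B, forall t, 0 <= t -> Rabs (vmul y (p t) j) <= B).
  { intros y Hy. exists (Series (fun i => Rabs (y i))). intros t Ht.
    apply Series_dominated; [|exact Hy]. intros i. rewrite Rabs_mult.
    rewrite <- (Rmult_1_r (Rabs (y i))) at 2.
    apply Rmult_le_compat_l; [apply Rabs_pos|now apply tf_Rabs_le1]. }
  destruct (Hbd x Hx) as [B1 HB1]. destruct (Hbd _ Hxq) as [B2 HB2].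
  assert (D1 := uniform_derivative_discount _ _ lambda (Rmax B1 B2) Hl
    (flow_derivative p q M x j Hc Hq Hx)
    (fun t Ht => Rle_trans _ _ _ (HB1 t Ht) (Rmax_l _ _))
    (fun t Ht => Rle_trans _ _ _ (HB2 t Ht) (Rmax_r _ _))).
  assert (D2 : uniform_derivative (fun t => Series (fun i => g i * I i t))
    (fun t => Series (fun i => g i * (exp (- lambda * t) * p t i j)))).
  { apply (uniform_derivative_quadratic _ _
      ((lambda + 6 * M) * Series (fun i => Rabs (g i)))).
    intros t s Ht Hs.
    rewrite <- Series_minus by (apply HgI; lra).
    rewrite <- Series_scal_l, <- Series_minus.
    - rewrite !Rmult_assoc, (Rmult_comm (Series _)), <- !Rmult_assoc, <- Series_scal_l.
      apply Series_dominated; [|now apply ex_series_Rmult].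
      intros i.
      replace (g i * I i (t + s) - g i * I i t - s * (g i * (exp (- lambda * t) * p t i j)))
        with (g i * (I i (t + s) - I i t - s * (exp (- lambda * t) * p t i j))) by ring.
      rewrite Rabs_mult, Rmult_comm. apply Rmult_le_compat_r; [apply Rabs_pos|].
      apply (Lipschitz_RInt_step (fun t => exp (- lambda * t) * p t i j)); [|lra|lra].
      intros a b Ha Hb. now apply (discounted_Lipschitz p q M).
    - apply ex_series_Rminus; apply HgI; lra.
    - apply ex_series_Rmult. now apply Hgv. }
  set (G := fun t => exp (- lambda * t) * vmul x (p t) j + Series (fun i => g i * I i t)).
  assert (DG : uniform_derivative G (fun _ => 0)).
  { eapply uniform_derivative_ext; [| |exact (uniform_derivative_plus _ _ _ _ D1 D2)].
    - reflexivity.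
    - intros t Ht. cbv beta.
      rewrite (Series_ext _ (fun i => exp (- lambda * t)
        * (lambda * (x i * p t i j) - vmul x q i * p t i j))) by (intros i; unfold g; ring).
      rewrite Series_scal_l, Series_minus, Series_scal_l;
        [|apply ex_series_Rmult; now apply Hvm|now apply Hvm].
      fold (vmul x (p t) j) (vmul (vmul x q) (p t) j). ring. }
  assert (HG : forall t, 0 <= t -> G t = x j).
  { intros t Ht. rewrite (uniform_derivative_0 G DG t Ht). unfold G.
    rewrite Rmult_0_r, exp_0, vmul_init by assumption.
    rewrite (Series_ext _ (fun _ => 0)).
    - rewrite Series_0. ring.
    - intros i. unfold I. rewrite RInt_point. unfold zero; simpl. ring. }
  assert (L1 : filterlim (fun t => exp (- lambda * t) * vmul x (p t) j)
    (Rbar_locally p_infty) (locally 0)).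
  { apply (filterlim_Rabs_lt (Rbar_locally p_infty)). intros eps He.
    assert (HB0 : 0 <= B1) by (eapply Rle_trans; [apply Rabs_pos|apply (HB1 0); lra]).
    assert (He' : 0 < eps / (B1 + 1)) by (apply Rdiv_lt_0_compat; lra).
    destruct (proj1 (filterlim_Rabs_lt (Rbar_locally p_infty) _ _)
      (exp_discount_lim lambda Hl) _ He') as [N HN].
    exists (Rmax N 0). intros t Ht.
    assert (Ha := Rmax_l N 0). assert (Hb := Rmax_r N 0).
    specialize (HN t ltac:(lra)). specialize (HB1 t ltac:(lra)).
    rewrite Rminus_0_r in HN |- *. rewrite Rabs_mult.
    apply Rle_lt_trans with (Rabs (exp (- lambda * t)) * (B1 + 1)).
    - apply Rmult_le_compat_l; [apply Rabs_pos|lra].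
    - apply (Rmult_lt_compat_r (B1 + 1)) in HN; [|lra].
      replace (eps / (B1 + 1) * (B1 + 1)) with eps in HN by (field; lra). assumption. }
  assert (Hinf : Rbar_locally p_infty (fun t => 0 <= t)) by (exists 0; intros t Ht; lra).
  assert (L2 : filterlim (fun T => Series (fun i => g i * I i T))
    (Rbar_locally p_infty) (locally (Series (fun i => g i * resolvent p i j lambda)))
    /\ ex_series (fun i => g i * resolvent p i j lambda)).
  { assert (Hres : forall i, Rabs (resolvent p i j lambda) <= / lambda).
    { intros i. apply Rnot_lt_le. intros Hlt.
      destruct (resolvent_integral_bounds p q M lambda i j Hc Hq Hl) as [_ Hlim].
      destruct (filter_ex (F := Rbar_locally p_infty) _
        (filter_and (F := Rbar_locally p_infty) _ _ Hinf
        (proj1 (filterlim_Rabs_lt (Rbar_locally p_infty) _ _) Hlim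
          (Rabs (resolvent p i j lambda) - / lambda) ltac:(lra)))) as [T [HT HTl]].
      specialize (HI i T HT). fold (I i T) in HTl.
      assert (Ht := Rabs_triang_inv (resolvent p i j lambda) (I i T)).
      rewrite Rabs_minus_sym in Ht. lra. }
    assert (Hgl : ex_series (fun i => / lambda * Rabs (g i))) by now apply ex_series_Rmult.
    assert (Hmul : forall i y, Rabs y <= / lambda -> Rabs (g i * y) <= / lambda * Rabs (g i)).
    { intros i y Hy. rewrite Rabs_mult, Rmult_comm.
      apply Rmult_le_compat_r; [apply Rabs_pos|assumption]. }
    split.
    - apply (dominated_convergence_series (Rbar_locally p_infty))
        with (g := fun i => / lambda * Rabs (g i)).
      + exact Hgl.
      + intros i. now apply Hmul.
      + generalize Hinf. apply filter_imp. intros T HT i. apply Hmul. now apply HI.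
      + intros i. exact (filterlim_comp _ _ _ _ _ _ _ _
          (proj2 (resolvent_integral_bounds p q M lambda i j Hc Hq Hl))
          (filterlim_scal_r (g i) (resolvent p i j lambda : R_NormedModule))).
    - apply (ex_series_dominated _ (fun i => / lambda * Rabs (g i))); [|exact Hgl].
      intros i. now apply Hmul. }
  destruct L2 as [L2 Hexr].
  assert (L3 : filterlim G (Rbar_locally p_infty)
    (locally (0 + Series (fun i => g i * resolvent p i j lambda)))).
  { exact (filterlim_comp_2 _ _ Rplus L1 L2
      (filterlim_plus (0 : R_NormedModule) (Series (fun i => g i * resolvent p i j lambda)))). }
  assert (L4 : filterlim G (Rbar_locally p_infty) (locally (x j))).
  { apply (filterlim_ext_loc (fun _ => x j)); [|apply filterlim_const].
    generalize Hinf. apply filter_imp. intros t Ht. symmetry. now apply HG. }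
  eapply is_series_value; [exact (Series_Rcorrect _ Hexr)|].
  assert (Hu := filterlim_locally_unique G _ _ L3 L4). cbv beta in Hu. lra.
Qed.

(** * The matrices of the queue and their generating functions *)

Lemma is_series_shift (n : nat) : forall (a : nat -> R) (l : R),
  (forall j, (j < n)%nat -> a j = 0) ->
  is_series (fun k => a (n + k)%nat) l -> is_series a l.
Proof.
  induction n as [|n IH]; intros a l Ha H; [exact H|].
  apply is_series_decr_1. rewrite Ha by lia.
  apply (is_series_value _ l); [|unfold plus, opp; simpl; ring].
  apply (IH (fun k => a (S k))); [|exact H]. intros j Hj. apply Ha. lia.
Qed.

Lemma Series_finite (a : nat -> R) (n : nat) :
  (forall k, (n < k)%nat -> a k = 0) -> is_series (fun i => a (S i)) (sum_n_m a 1 n).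
Proof.
  intros Ha. destruct n as [|n].
  - rewrite sum_n_m_zero by lia. apply is_series_Rext with (fun _ => 0).
    + intros i. symmetry. apply Ha. lia.
    + eapply is_series_value; [apply Series_Rcorrect|apply Series_0].
      apply (ex_series_Rext (fun k => kron 0 k * 0)); [intros; ring|].
      eexists; exact (is_series_kron (fun _ => 0) 0).
  - rewrite <- sum_n_m_S. change (sum_n_m (fun k => a (S k)) 0 n) with (sum_n (fun k => a (S k)) n).
    apply is_series_filterlim. apply (filterlim_Rabs_lt eventually). intros eps He.
    exists n. intros m Hm. rewrite sum_n_Reals.
    replace (sum_f_R0 (fun i => a (S i)) m) with (sum_f_R0 (fun k => a (S k)) n).
    + rewrite Rminus_diag, Rabs_R0. assumption.
    + induction Hm as [|m Hm IH]; [reflexivity|]. simpl. rewrite <- IH, (Ha (S (S m))) by lia.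
      ring.
Qed.

Lemma pow_le1 s n : 0 <= s <= 1 -> 0 <= s ^ n <= 1.
Proof.
  intros Hs. split; [now apply pow_le|]. rewrite <- (pow1 n). apply pow_incr. lra.
Qed.

Lemma b_total (b : nat -> R) :
  is_series (fun j => if Nat.eqb j 1 then 0 else b j) (- b 1%nat) -> is_series b 0.
Proof.
  intros H.
  eapply is_series_Rext; [|eapply is_series_value; [apply is_series_Rplus;
    [exact H|exact (is_series_kron b 1)]|]].
  - intros k. unfold kron. rewrite Nat.eqb_sym. destruct (Nat.eqb_spec 1 k) as [<-|Hk]; ring.
  - ring.
Qed.

(** Only [b 1] may be negative, so [|b|] and [b] differ in one term. *)
Lemma b_l1 (b : nat -> R) :
  (forall j, j <> 1%nat -> 0 <= b j) -> is_series b 0 -> l1 b.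
Proof.
  intros Hb H.
  apply (ex_series_Rext (fun k => b k + (Rabs (b 1%nat) - b 1%nat) * kron 1 k)).
  - intros k. destruct (Nat.eq_dec 1 k) as [<-|Hk].
    + rewrite kron_refl. ring.
    + rewrite (kron_neq 1 k Hk), (Rabs_pos_eq (b k)) by (apply Hb; lia). ring.
  - apply ex_series_Rplus; [eexists; exact H|]. apply ex_series_Rmult.
    eexists; apply is_series_kron1.
Qed.

Lemma Bfun_series (b : nat -> R) s : l1 b -> 0 <= s <= 1 ->
  is_series (fun k => b k * s ^ k) (Bfun b s).
Proof.
  intros Hb Hs. apply Series_Rcorrect. apply (ex_series_l1_mult _ _ 1 Hb).
  intros k. rewrite Rabs_pos_eq; now apply pow_le1.
Qed.

Lemma Bfun_1 (b : nat -> R) : is_series b 0 -> Bfun b 1 = 0.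
Proof.
  intros H. apply is_series_unique. eapply is_series_Rext; [|exact H].
  intros k. cbv beta. rewrite pow1. ring.
Qed.

(** From state [i + 1] the queue moves to [i + k] at rate [b k], except that
    [min (i + 1) c] busy servers multiply the departure rate [b 0]; the
    diagonal compensates.  Indexing by the distance [k] from [i] makes every row
    the same sequence up to this correction. *)
Lemma qstar_entry b c i k :
  qstar b c (S i) (i + k)
    = b k + (INR (Nat.min (S i) c) - 1) * b 0%nat * (kron 0 k - kron 1 k).
Proof.
  unfold qstar, kron. destruct k as [|[|k]]; simpl (Nat.eqb _ _).
  - rewrite Nat.add_0_r, Nat.eqb_refl. ring.
  - replace (i + 1 =? i)%nat with false by (symmetry; apply Nat.eqb_neq; lia).
    replace (i + 1 =? S i)%nat with true by (symmetry; apply Nat.eqb_eq; lia). ring.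
  - replace (i + S (S k) =? i)%nat with false by (symmetry; apply Nat.eqb_neq; lia).
    replace (i + S (S k) =? S i)%nat with false by (symmetry; apply Nat.eqb_neq; lia).
    replace (S i <? i + S (S k))%nat with true by (symmetry; apply Nat.ltb_lt; lia).
    replace (i + S (S k) - S i + 1)%nat with (S (S k)) by lia. ring.
Qed.

Lemma qstar_low b c i j : (j < i)%nat -> qstar b c (S i) j = 0.
Proof.
  intros Hj. unfold qstar.
  replace (j =? i)%nat with false by (symmetry; apply Nat.eqb_neq; lia).
  replace (j =? S i)%nat with false by (symmetry; apply Nat.eqb_neq; lia).
  now replace (S i <? j)%nat with false by (symmetry; apply Nat.ltb_ge; lia).
Qed.

Lemma qstar_row_gf b c i s :
  l1 b -> 0 <= s <= 1 ->
  is_series (fun j => qstar b c (S i) j * s ^ j)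
    (s ^ i * (Bfun b s + (INR (Nat.min (S i) c) - 1) * b 0%nat * (1 - s))).
Proof.
  intros Hb Hs. set (m := INR (Nat.min (S i) c)).
  apply (is_series_shift i).
  { intros j Hj. rewrite qstar_low by assumption. ring. }
  eapply is_series_Rext; [|eapply is_series_value; [
    apply (is_series_Rmult (s ^ i)); apply is_series_Rplus; [
      exact (Bfun_series b s Hb Hs)|
      apply (is_series_Rmult ((m - 1) * b 0%nat)); apply is_series_Rplus; [
        exact (is_series_kron (fun k => s ^ k) 0)|
        exact (is_series_Rmult (-1) _ _ (is_series_kron (fun k => s ^ k) 1))]]|]].
  - intros k. cbv beta. rewrite qstar_entry, pow_add. fold m. ring.
  - ring.
Qed.

Lemma Hfun_series (h : nat -> R) s :
  (forall j, (1 <= j)%nat -> 0 <= h j) -> ex_series (fun j => h (S j)) -> 0 <= s <= 1 ->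
  is_series (fun j => h (S j) * s ^ S j) (Hfun h s).
Proof.
  intros Hh He Hs. apply Series_Rcorrect. apply (ex_series_dominated _ (fun j => h (S j))).
  - intros j. assert (H1 := Hh (S j) ltac:(lia)). assert (H2 := pow_le1 s (S j) Hs).
    rewrite Rabs_pos_eq by (apply Rmult_le_pos; lra).
    rewrite <- (Rmult_1_r (h (S j))) at 2. apply Rmult_le_compat_l; lra.
  - exact He.
Qed.

Lemma Hfun_1 (h : nat -> R) : Hfun h 1 = htot h.
Proof. apply Series_ext. intros j. rewrite pow1. ring. Qed.

Lemma qmat_entry_S b h beta c i j :
  qmat b h beta c (S i) j = qstar b c (S i) j + beta * (kron 0 j - kron (S i) j).
Proof.
  unfold qmat, qs, qd, kron. destruct (Nat.eqb_spec j 0) as [->|Hj].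
  - rewrite Nat.eqb_refl. replace (S i =? 0)%nat with false by reflexivity. ring.
  - replace (0 =? j)%nat with false by (symmetry; apply Nat.eqb_neq; lia).
    rewrite (Nat.eqb_sym (S i) j). destruct (j =? S i)%nat; ring.
Qed.

Lemma qmat_row_gf_0 b h beta c s :
  (forall j, (1 <= j)%nat -> 0 <= h j) -> ex_series (fun j => h (S j)) -> 0 <= s <= 1 ->
  is_series (fun j => qmat b h beta c 0 j * s ^ j) (Hfun h s - htot h).
Proof.
  intros Hh He Hs. apply is_series_decr_1.
  eapply is_series_Rext; [|eapply is_series_value; [exact (Hfun_series h s Hh He Hs)|]].
  - intros k. unfold qmat, qs, qd, qstar. ring.
  - unfold qmat, qs, qd, qstar, plus, opp; simpl. ring.
Qed.

Lemma qmat_row_gf_S b h beta c i s :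
  l1 b -> 0 <= s <= 1 ->
  is_series (fun j => qmat b h beta c (S i) j * s ^ j)
    (s ^ i * (Bfun b s + (INR (Nat.min (S i) c) - 1) * b 0%nat * (1 - s))
     + beta * (1 - s ^ S i)).
Proof.
  intros Hb Hs.
  eapply is_series_Rext; [|eapply is_series_value; [
    apply is_series_Rplus; [exact (qstar_row_gf b c i s Hb Hs)|
      apply (is_series_Rmult beta); apply is_series_Rplus; [
        exact (is_series_kron (fun k => s ^ k) 0)|
        exact (is_series_Rmult (-1) _ _ (is_series_kron (fun k => s ^ k) (S i)))]]|]].
  - intros k. cbv beta. rewrite qmat_entry_S. ring.
  - simpl. ring.
Qed.

Lemma qstar_bounded_generator b c :
  (1 <= c)%nat -> (forall j, j <> 1%nat -> 0 <= b j) -> 0 <= - b 1%nat -> is_series b 0 ->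
  bounded_generator (qstar b c) (- b 1%nat + INR c * b 0%nat).
Proof.
  intros Hc Hb Hb1 Hs. assert (Hb0 : 0 <= b 0%nat) by (apply Hb; lia).
  assert (Hcb : 0 <= INR c * b 0%nat) by (apply Rmult_le_pos; [apply pos_INR|assumption]).
  split.
  - intros i j Hij. destruct i as [|i]; [simpl; lra|].
    destruct (Nat.lt_ge_cases j i) as [Hj|Hj].
    + rewrite qstar_low by assumption. lra.
    + replace j with (i + (j - i))%nat by lia.
      rewrite qstar_entry. destruct (Nat.eq_dec (j - i) 0) as [->|Hk].
      * rewrite kron_refl, kron_neq by lia.
        assert (0 <= INR (Nat.min (S i) c) * b 0%nat)
          by (apply Rmult_le_pos; [apply pos_INR|assumption]). lra.
      * rewrite !kron_neq by lia. assert (H := Hb (j - i)%nat ltac:(lia)). lra.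
  - intros [|i].
    + apply (is_series_Rext (fun k => kron 0 k * 0)); [intros k; simpl; ring|].
      exact (is_series_kron (fun _ => 0) 0).
    + eapply is_series_Rext; [|eapply is_series_value; [
        apply (qstar_row_gf b c i 1); [now apply b_l1|lra]|]].
      * intros k. cbv beta. rewrite pow1. ring.
      * rewrite Bfun_1 by assumption. ring.
  - intros [|i]; [simpl; lra|].
    replace (qstar b c (S i) (S i)) with (qstar b c (S i) (i + 1)) by (f_equal; lia).
    rewrite qstar_entry, kron_refl, kron_neq by lia.
    assert (INR (Nat.min (S i) c) <= INR c) by (apply le_INR; lia).
    assert (INR (Nat.min (S i) c) * b 0%nat <= INR c * b 0%nat)
      by (apply Rmult_le_compat_r; lra).
    lra.
Qed.

Lemma qmat_bounded_generator b h beta c :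
  (1 <= c)%nat -> (forall j, j <> 1%nat -> 0 <= b j) -> 0 <= - b 1%nat -> is_series b 0 ->
  (forall j, (1 <= j)%nat -> 0 <= h j) -> ex_series (fun j => h (S j)) -> 0 <= beta ->
  bounded_generator (qmat b h beta c) (- b 1%nat + INR c * b 0%nat + beta + htot h).
Proof.
  intros Hc Hb Hb1 Hs Hh He Hbeta.
  assert (Hq := qstar_bounded_generator b c Hc Hb Hb1 Hs).
  assert (Hh0 : 0 <= htot h) by (apply Series_nonneg; [intros; apply Hh; lia|exact He]).
  assert (Hl1 : l1 b) by now apply b_l1.
  split.
  - intros [|i] j Hij.
    + unfold qmat. destruct j as [|j]; [easy|].
      assert (H := Hh (S j) ltac:(lia)). simpl. lra.
    + rewrite qmat_entry_S. rewrite (kron_neq (S i) j Hij).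
      assert (H := bg_off _ _ Hq (S i) j Hij). assert (Hk := kron_ge0 0 j).
      assert (0 <= beta * (kron 0 j - 0)) by (apply Rmult_le_pos; lra). lra.
  - intros [|i].
    + eapply is_series_Rext; [|eapply is_series_value; [
        apply (qmat_row_gf_0 b h beta c 1); [assumption|assumption|lra]|]].
      * intros k. cbv beta. rewrite pow1. ring.
      * rewrite Hfun_1. ring.
    + eapply is_series_Rext; [|eapply is_series_value; [
        apply (qmat_row_gf_S b h beta c i 1); [assumption|lra]|]].
      * intros k. cbv beta. rewrite pow1. ring.
      * rewrite Bfun_1, !pow1 by assumption. ring.
  - assert (H0 := bg_bound _ _ Hq). intros [|i].
    + specialize (H0 0%nat). unfold qmat, qs, qd. simpl qstar in *. lra.
    + rewrite qmat_entry_S, kron_refl, kron_neq by lia. specialize (H0 (S i)). lra.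
Qed.

Lemma pow_convex_towards_1 a theta k :
  0 <= a <= 1 -> 0 <= theta <= 1 ->
  (theta * a + (1 - theta)) ^ k <= theta * a ^ k + (1 - theta).
Proof.
  intros Ha Ht. induction k as [|k IH]; [simpl; lra|].
  assert (Hk := pow_le1 a k Ha). simpl. set (x := a ^ k) in *.
  assert (Hd : 0 <= theta * a + (1 - theta)) by nra.
  apply Rle_trans with ((theta * a + (1 - theta)) * (theta * x + (1 - theta))).
  - now apply Rmult_le_compat_l.
  - assert (0 <= theta * (1 - theta) * ((1 - a) * (1 - x)))
      by (repeat apply Rmult_le_pos; lra). lra.
Qed.

(** [U] is convex, so beyond the root [a] it lies below its chord over [[a, 1]],
    which falls from [0] to [- lambda]. *)
Lemma Ufun_neg_after_root b c lambda a d :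
  (forall j, j <> 1%nat -> 0 <= b j) -> is_series b 0 -> 0 < lambda ->
  0 <= a < d -> d <= 1 -> Ufun b c lambda a = 0 -> Ufun b c lambda d < 0.
Proof.
  intros Hb Hs Hl Had Hd HU.
  assert (Hl1 : l1 b) by now apply b_l1.
  set (theta := (1 - d) / (1 - a)).
  assert (Hth : 0 <= theta < 1).
  { unfold theta. split; [apply Rdiv_le_0_compat; lra|]. apply Rlt_div_l; lra. }
  assert (Hdt : d = theta * a + (1 - theta)) by (unfold theta; field; lra).
  assert (HB : Bfun b d <= theta * Bfun b a).
  { assert (Sd := Bfun_series b d Hl1 ltac:(lra)).
    assert (Sa := Bfun_series b a Hl1 ltac:(lra)).
    assert (Sdiff := is_series_Rplus _ _ _ _ (is_series_Rplus _ _ _ _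
      (is_series_Rmult theta _ _ Sa) (is_series_Rmult (1 - theta) _ _ Hs))
      (is_series_Rmult (-1) _ _ Sd)).
    enough (Hnn : 0 <= Series (fun k => theta * (b k * a ^ k) + (1 - theta) * b k
                                        + -1 * (b k * d ^ k)))
      by (rewrite (is_series_unique _ _ Sdiff) in Hnn; lra).
    apply Series_nonneg; [|eexists; exact Sdiff]. intros k.
    replace (theta * (b k * a ^ k) + (1 - theta) * b k + -1 * (b k * d ^ k))
      with (b k * (theta * a ^ k + (1 - theta) - d ^ k)) by ring.
    destruct (Nat.eq_dec k 1) as [->|Hk].
    - rewrite !pow_1, <- Hdt, Rminus_diag. lra.
    - apply Rmult_le_pos; [now apply Hb|].
      assert (H := pow_convex_towards_1 a theta k ltac:(lra) ltac:(lra)). rewrite <- Hdt in H. lra. }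
  unfold Ufun, Bcfun in *.
  replace (1 - d) with (theta * (1 - a)) by (rewrite Hdt at 1; ring).
  replace (lambda * d) with (theta * (lambda * a) + (1 - theta) * lambda)
    by (rewrite Hdt at 1; ring).
  assert (0 < (1 - theta) * lambda) by (apply Rmult_lt_0_compat; lra).
  assert (HU' : theta * (Bfun b a + (INR c - 1) * b 0%nat * (1 - a) - lambda * a) = 0)
    by (rewrite HU; ring).
  lra.
Qed.

Lemma Ufun_neq0 b c lambda u s :
  (forall j, j <> 1%nat -> 0 <= b j) -> is_series b 0 -> 0 < lambda ->
  0 <= u <= 1 -> Ufun b c lambda u = 0 -> 0 <= s <= 1 -> s <> u ->
  Ufun b c lambda s <> 0.
Proof.
  intros Hb Hs Hl Hu HU Hs01 Hne HUs.
  destruct (Rtotal_order s u) as [H|[H|H]]; [|contradiction|].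
  - assert (H' := Ufun_neg_after_root b c lambda s u Hb Hs Hl ltac:(lra) ltac:(lra) HUs). lra.
  - assert (H' := Ufun_neg_after_root b c lambda u s Hb Hs Hl ltac:(lra) ltac:(lra) HU). lra.
Qed.

(** * The equilibrium of the queue *)

(** A state that is never left reaches no other: [diag_lower_bound] gives
    [p_00(t) = 1]. *)
Lemma absorbing_resolvent p q M lambda j :
  is_chain q p -> bounded_generator q M -> 0 < lambda ->
  q 0%nat 0%nat = 0 -> (1 <= j)%nat -> resolvent p 0 j lambda = 0.
Proof.
  intros Hc Hq Hl H0 Hj. pose proof (proj1 Hc) as Hp.
  assert (Hz : forall t, 0 <= t -> p t 0%nat j = 0).
  { intros t Ht. apply Rle_antisym; [|now apply (tf_ge0 p Hp)].
    assert (H := diag_lower_bound p q t 0 Hc Ht). rewrite H0, Rmult_0_r in H.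
    assert (Hs := tf_sum1 p Hp t 0%nat Ht).
    assert (He : ex_series (fun k => p t 0%nat k)) by (eexists; exact Hs).
    apply is_series_unique in Hs. rewrite (Series_incr_1 _ He) in Hs.
    destruct j as [|j]; [lia|].
    assert (p t 0%nat (S j) <= Series (fun k => p t 0%nat (S k))); [|lra].
    apply (term_le_Series (fun k => p t 0%nat (S k))).
    - intros k. now apply (tf_ge0 p Hp).
    - now apply -> (ex_series_incr_1 (fun k => p t 0%nat k)). }
  destruct (resolvent_integral_bounds p q M lambda 0 j Hc Hq Hl) as [_ Hlim].
  refine (filterlim_locally_unique _ _ _ Hlim _).
  apply (filterlim_ext_loc (fun _ => 0)); [|apply filterlim_const].
  exists 0. intros T HT.
  rewrite (RInt_ext _ (fun _ => 0)).
  - rewrite RInt_const. symmetry. exact (Rmult_0_r (T - 0)).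
  - intros x Hx. rewrite Rmin_left in Hx by lra. rewrite Hz by lra. exact (Rmult_0_r _).
Qed.

(** In the columns [k >= 1], [pi Q = 0] reads [beta pi_k - (pi Qstar)_k = pi_0 h_k].
    The entry of [beta pi - pi Qstar] at [0] is unknown, but it is multiplied by
    [Phi_0j], which vanishes because [0] is absorbing for [Qstar]. *)
Lemma stationary_resolvent b h beta c pi pstar M j :
  is_chain (qstar b c) pstar -> bounded_generator (qstar b c) M -> 0 < beta ->
  l1 pi -> (forall k, vmul pi (qmat b h beta c) k = 0) -> (1 <= j)%nat ->
  pi j = pi 0%nat * Lfun h pstar j beta.
Proof.
  intros Hc Hq Hbeta Hpi Hst Hj.
  assert (Hg : forall k, (1 <= k)%nat ->
    beta * pi k - vmul pi (qstar b c) k = pi 0%nat * h k).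
  { intros k Hk.
    assert (Hex : ex_series (fun i => pi i * qstar b c i k)).
    { apply (ex_series_l1_mult _ _ (2 * M) Hpi). intros i.
      now apply (rows_bounded_entry _ _ i k (bg_rows_bounded _ _ Hq)). }
    assert (Hsum := is_series_Rplus _ _ _ _ (is_series_Rplus _ _ _ _
      (Series_Rcorrect _ Hex)
      (is_series_kron (fun i => pi i * h k) 0))
      (is_series_Rmult (- beta) _ _ (is_series_kron pi k))).
    specialize (Hst k). unfold vmul in Hst at 1.
    rewrite (Series_ext _ (fun i => pi i * qstar b c i k + kron 0 i * (pi i * h k)
                                    + - beta * (kron k i * pi i))) in Hst.
    - rewrite (is_series_unique _ _ Hsum) in Hst. fold (vmul pi (qstar b c) k) in Hst. lra.
    - intros [|i].
      + rewrite kron_refl, kron_neq by lia. destruct k as [|k]; [lia|].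
        unfold qmat, qs, qd. ring.
      + rewrite qmat_entry_S, !(kron_neq 0) by lia.
        replace (kron k (S i)) with (kron (S i) k) by (unfold kron; now rewrite Nat.eqb_sym).
        ring. }
  assert (Hr := resolvent_equation pstar (qstar b c) M beta pi j Hc Hq Hbeta Hpi).
  rewrite <- (is_series_unique _ _ Hr).
  rewrite Series_incr_1 by (eexists; exact Hr).
  rewrite (absorbing_resolvent pstar (qstar b c) M) by (assumption || reflexivity).
  unfold Lfun. rewrite <- Series_scal_l, Rmult_0_r, Rplus_0_l.
  apply Series_ext. intros i. rewrite Hg by lia. ring.
Qed.

(** Pair [pi Q = 0] with the column [s ^ k] and multiply by [s].  The row of
    [i >= 1] contributes [s ^ i U(s) + s beta], less a correction for the
    [c - i] idle servers that vanishes for [i >= c]; this leaves a finite sum. *)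
Lemma balance_equation b h beta c pi s :
  (1 <= c)%nat -> (forall j, j <> 1%nat -> 0 <= b j) -> 0 <= - b 1%nat -> is_series b 0 ->
  (forall j, (1 <= j)%nat -> 0 <= h j) -> ex_series (fun j => h (S j)) -> 0 <= beta ->
  (forall j, 0 <= pi j) -> is_series pi 1 ->
  (forall k, vmul pi (qmat b h beta c) k = 0) -> 0 <= s <= 1 ->
  (PSeries pi s - pi 0%nat) * Ufun b c beta s
    = s * pi 0%nat * (Hfun h 1 - Hfun h s) - s * beta * (1 - pi 0%nat)
      + sum_n_m (fun k => pi k * (INR c - INR k) * b 0%nat * (s ^ k * (1 - s))) 1 (c - 1).
Proof.
  intros Hc Hb Hb1 Hbs Hh He Hbeta Hpi0 Hpi1 Hst Hs.
  assert (Hl1 : l1 b) by now apply b_l1.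
  assert (Hpi : l1 pi).
  { apply (ex_series_Rext pi); [|eexists; exact Hpi1].
    intros k. symmetry. now apply Rabs_pos_eq. }
  assert (Hq := qmat_bounded_generator b h beta c Hc Hb Hb1 Hbs Hh He Hbeta).
  assert (Hpow : forall k, Rabs (s ^ k) <= 1).
  { intros k. assert (H := pow_le1 s k Hs). rewrite Rabs_pos_eq; lra. }
  assert (H0 : Series (fun i => pi i * Series (fun k => qmat b h beta c i k * s ^ k)) = 0).
  { rewrite <- (is_series_unique _ _ (vmul_assoc pi _ (fun k => s ^ k) _ 1 Hpi
      (bg_rows_bounded _ _ Hq) Hpow)).
    rewrite (Series_ext _ (fun _ => 0)); [apply Series_0|]. intros k. rewrite Hst. ring. }
  assert (Hgs : is_series (fun k => pi k * s ^ k) (PSeries pi s)).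
  { apply Series_Rcorrect. now apply (ex_series_l1_mult _ _ 1 Hpi). }
  set (F := fun k => pi k * (INR c - INR (Nat.min k c)) * b 0%nat * (s ^ k * (1 - s))).
  assert (HF : is_series (fun i => F (S i))
    (sum_n_m (fun k => pi k * (INR c - INR k) * b 0%nat * (s ^ k * (1 - s))) 1 (c - 1))).
  { eapply is_series_value; [apply (Series_finite F (c - 1))|].
    - intros k Hk. unfold F. rewrite Nat.min_r by lia. ring.
    - apply sum_n_m_ext_loc. intros k Hk. unfold F. now rewrite Nat.min_l by lia. }
  assert (Hgs1 : is_series (fun k => pi (S k) * s ^ S k) (PSeries pi s - pi 0%nat)).
  { apply (is_series_incr_1 (fun k => pi k * s ^ k)).
    eapply is_series_value; [exact Hgs|]. unfold plus; simpl. ring. }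
  assert (Hpi1' : is_series (fun k => pi (S k)) (1 - pi 0%nat)).
  { apply (is_series_incr_1 pi).
    eapply is_series_value; [exact Hpi1|]. unfold plus; simpl. ring. }
  assert (Hrest : is_series
    (fun i => s * (pi (S i) * Series (fun k => qmat b h beta c (S i) k * s ^ k)))
    ((PSeries pi s - pi 0%nat) * Ufun b c beta s + s * beta * (1 - pi 0%nat)
     - sum_n_m (fun k => pi k * (INR c - INR k) * b 0%nat * (s ^ k * (1 - s))) 1 (c - 1))).
  { eapply is_series_Rext; [|eapply is_series_value; [
      apply is_series_Rplus; [apply is_series_Rplus; [
        exact (is_series_Rmult (Ufun b c beta s) _ _ Hgs1)|
        exact (is_series_Rmult (s * beta) _ _ Hpi1')]|
      exact (is_series_Rmult (-1) _ _ HF)]|]].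
    - intros i. cbv beta.
      rewrite (is_series_unique _ _ (qmat_row_gf_S b h beta c i s Hl1 Hs)).
      unfold F, Ufun, Bcfun. simpl (s ^ S i). ring.
    - ring. }
  assert (Hall : ex_series (fun i => pi i * Series (fun k => qmat b h beta c i k * s ^ k))).
  { apply (ex_series_l1_mult _ _ (2 * (- b 1%nat + INR c * b 0%nat + beta + htot h)) Hpi).
    intros i. destruct (bg_rows_bounded _ _ Hq i) as [H1 H2].
    eapply Rle_trans; [|exact H2]. apply Series_dominated; [|exact H1].
    intros k. rewrite Rabs_mult. rewrite <- (Rmult_1_r (Rabs (qmat _ _ _ _ _ _))) at 2.
    apply Rmult_le_compat_l; [apply Rabs_pos|apply Hpow]. }
  rewrite Series_incr_1 in H0 by exact Hall.
  rewrite (is_series_unique _ _ (qmat_row_gf_0 b h beta c s Hh He Hs)) in H0.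
  apply is_series_unique in Hrest. rewrite Series_scal_l in Hrest.
  apply (f_equal (Rmult s)) in H0.
  rewrite Rmult_plus_distr_l, Hrest in H0. rewrite Hfun_1. lra.
Qed.

Lemma sum_n_m_Rext (u v : nat -> R) n m :
  (forall k, (n <= k <= m)%nat -> u k = v k) -> sum_n_m u n m = sum_n_m v n m.
Proof. exact (sum_n_m_ext_loc u v n m). Qed.

Lemma sum_n_m_Rmult (a : R) (u : nat -> R) n m :
  sum_n_m (fun k => a * u k) n m = a * sum_n_m u n m.
Proof. exact (sum_n_m_mult_l (K := R_Ring) a u n m). Qed.

Lemma sum_n_m_Rplus (u v : nat -> R) n m :
  sum_n_m (fun k => u k + v k) n m = sum_n_m u n m + sum_n_m v n m.
Proof. exact (sum_n_m_plus u v n m). Qed.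

Theorem theorem4p4
  (c : nat) (b h : nat -> R) (beta : R)
  (p pstar : R -> nat -> nat -> R) (u : R -> R)
  (c_ge1 : (1 <= c)%nat)
  (b_ge0 : forall j, j <> 1%nat -> 0 <= b j)
  (b1_neg : 0 < - b 1%nat)
  (b_sum : is_series (fun j => if Nat.eqb j 1 then 0 else b j) (- b 1%nat))
  (b0_gt0 : 0 < b 0%nat)
  (b_tail_gt0 : 0 < Series (fun j => b (S (S j))))
  (h_ge0 : forall j, (1 <= j)%nat -> 0 <= h j)
  (h_summable : ex_series (fun j => h (S j)))
  (h_gt0 : 0 < htot h)
  (beta_gt0 : 0 < beta)
  (p_chain : is_chain (qmat b h beta c) p)
  (pstar_chain : is_chain (qstar b c) pstar)
  (u_root : forall lambda, 0 < lambda ->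
     0 < u lambda < 1 /\ Ufun b c lambda (u lambda) = 0) :
  (exists pi, is_equilibrium p pi) /\
  forall pi, is_equilibrium p pi ->
    (forall s, 0 <= s <= 1 -> s <> u beta ->
       PSeries pi s =
         pi 0%nat * (1 + s * (Hfun h (u beta) - Hfun h s) / Ufun b c beta s)
         + sum_n_m (fun k => pi k * (INR c - INR k) * b 0%nat
               * (s ^ k * (1 - s) - s * u beta ^ (k - 1) * (1 - u beta)))
             1 (c - 1)
           / Ufun b c beta s) /\
    pi 0%nat =
      beta * / (beta + Hfun h 1 - Hfun h (u beta)
                + sum_n_m (fun k => Lfun h pstar k beta * u beta ^ (k - 1)
                      * (INR c - INR k) * b 0%nat * (1 - u beta)) 1 (c - 1)) /\
    (forall j, (1 <= j)%nat -> pi j = pi 0%nat * Lfun h pstar j beta).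
Proof.
  assert (Hbs := b_total b b_sum).
  assert (Hb1 : 0 <= - b 1%nat) by lra.
  assert (Hbeta : 0 <= beta) by lra.
  assert (Hq := qmat_bounded_generator b h beta c c_ge1 b_ge0 Hb1 Hbs h_ge0 h_summable Hbeta).
  assert (Hqs := qstar_bounded_generator b c c_ge1 b_ge0 Hb1 Hbs).
  assert (Hl1 : forall pi : nat -> R, (forall j, 0 <= pi j) -> is_series pi 1 -> l1 pi).
  { intros pi H0 H1. apply (ex_series_Rext pi); [|eexists; exact H1].
    intros k. symmetry. now apply Rabs_pos_eq. }
  split.
  { destruct (stationary_exists _ _ beta Hq beta_gt0) as (pi & H0 & H1 & Hst).
    - intros [|i] Hi; [lia|]. rewrite qmat_entry_S, kron_refl, kron_neq by lia.
      assert (H := bg_off _ _ Hqs (S i) 0%nat ltac:(lia)). lra.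
    - exists pi. split; [exact H0|exact H1|].
      apply (invariant_iff p _ _ pi p_chain Hq (Hl1 pi H0 H1)). exact Hst. }
  intros pi [H0 H1 Hinv].
  assert (Hst := proj1 (invariant_iff p _ _ pi p_chain Hq (Hl1 pi H0 H1)) Hinv).
  destruct (u_root beta beta_gt0) as [Hu HUu].
  assert (HL : forall j, (1 <= j)%nat -> pi j = pi 0%nat * Lfun h pstar j beta).
  { intros j Hj. exact (stationary_resolvent b h beta c pi pstar _ j pstar_chain Hqs
      beta_gt0 (Hl1 pi H0 H1) Hst Hj). }
  assert (Hbal := fun s => balance_equation b h beta c pi s c_ge1 b_ge0 Hb1 Hbs h_ge0
    h_summable Hbeta H0 H1 Hst).
  set (v := u beta) in *.
  set (T := sum_n_m (fun k => pi k * (INR c - INR k) * b 0%nat * (v ^ (k - 1) * (1 - v)))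
    1 (c - 1)).
  (* The balance equation at the root, divided by the root. *)
  assert (Hnorm : beta * (1 - pi 0%nat) = pi 0%nat * (Hfun h 1 - Hfun h v) + T).
  { assert (H := Hbal v ltac:(lra)). rewrite HUu in H.
    rewrite (sum_n_m_Rext _ (fun k => v *
      (pi k * (INR c - INR k) * b 0%nat * (v ^ (k - 1) * (1 - v))))) in H.
    - rewrite sum_n_m_Rmult in H. fold T in H.
      apply (Rmult_eq_reg_l v); lra.
    - intros [|k] Hk; [lia|]. simpl (S k - 1)%nat. rewrite Nat.sub_0_r.
      simpl. ring. }
  split; [|split; [|exact HL]].
  - intros s Hs Hne.
    assert (HU := Ufun_neq0 b c beta v s b_ge0 Hbs beta_gt0 ltac:(lra) HUu Hs Hne).
    specialize (Hbal s Hs).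
    rewrite (sum_n_m_Rext (fun k => pi k * (INR c - INR k) * b 0%nat
               * (s ^ k * (1 - s) - s * v ^ (k - 1) * (1 - v)))
      (fun k => pi k * (INR c - INR k) * b 0%nat * (s ^ k * (1 - s))
        + - s * (pi k * (INR c - INR k) * b 0%nat * (v ^ (k - 1) * (1 - v))))).
    2:{ intros k _. cbv beta. ring. }
    rewrite sum_n_m_Rplus, sum_n_m_Rmult. fold T.
    set (D := sum_n_m (fun k => pi k * (INR c - INR k) * b 0%nat * (s ^ k * (1 - s)))
      1 (c - 1)) in *.
    assert (HP : PSeries pi s = pi 0%nat + (s * pi 0%nat * (Hfun h 1 - Hfun h s)
      - s * (beta * (1 - pi 0%nat)) + D) / Ufun b c beta s).
    { replace (s * (beta * (1 - pi 0%nat))) with (s * beta * (1 - pi 0%nat)) by ring.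
      rewrite <- Hbal. field. exact HU. }
    rewrite HP, Hnorm. field. exact HU.
  - set (A := beta + Hfun h 1 - Hfun h v + _).
    assert (HA : pi 0%nat * A = beta).
    { unfold A. rewrite Rmult_plus_distr_l.
      replace (pi 0%nat * sum_n_m (fun k => Lfun h pstar k beta * v ^ (k - 1)
                 * (INR c - INR k) * b 0%nat * (1 - v)) 1 (c - 1)) with T; [lra|].
      unfold T. rewrite <- sum_n_m_Rmult.
      apply sum_n_m_Rext. intros k Hk. rewrite (HL k) by lia.
      ring. }
    assert (HA0 : A <> 0) by (intros E; rewrite E in HA; lra).
    rewrite <- HA at 1. field. exact HA0.
Qed.
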